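(* The implication ''$u_k\in H_0^1(\Omega)$ is $D$-weakly convergent to zero $\Rightarrow$ $u_k\to0$ in $L^{\infty,q;-1/q-1/2}$'' (for domains $\Omega\subset B_{1/2}\subset\mathbb{R}^2$), does not extend to the endpoint $q=2$: there exist a domain $\Omega\subset B_{1/2}$ and a sequence $u_k\in H_0^1(\Omega)$ that is $D$-weakly convergent to zero but does not converge to zero in $L^{\infty,2;-1}$.
   Context: $B$ is the open unit disk in $\mathbb{R}^2$ centered at the origin, $B_{1/2}$ the open disk of radius $1/2$ centered at the origin. Points $z\in\mathbb{R}^2$ are identified with complex numbers, and $z^j$ ($j\in\mathbb{N}$) is the complex power. $H_0^1(B)$ and $H_0^1(\Omega)$ carry the norm $\|\nabla u\|_2$; functions in $H_0^1(\Omega)$ are extended by zero. The operator set is $$D=\{g_{j,\zeta}:\ (g_{j,\zeta}u)(z)=j^{-1/2}u(\zeta+z^j),\ z\in B,\ \zeta\in\bar\Omega,\ j\in\mathbb{N}\};$$ each $g_{j,\zeta}$ is a linear isometry from $H_0^1(\Omega)$ to $H_0^1(B)$. A sequence $u_k\in H_0^1(\Omega)$ is $D$-weakly convergent to zero if for every sequence $g_k\in D$ one has $g_ku_k\rightharpoonup0$ weakly in $H_0^1(B)$. For a measurable $u$ let $u^*(t)=\inf\{s>0:\ |\{|u|>s\}|\le t\}$ be its nonincreasing rearrangement. The Lorentz–Zygmund space $L^{\infty,q;\alpha}$, $q<\infty$, is given by the quasinorm $$\|u\|_{\infty,q;\alpha}=\left(\int_0^1\left[(\log\tfrac{e}{t})^{\alpha}u^*(t)\right]^q\frac{\mathrm{d}t}{t}\right)^{1/q}.$$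 *)

(* Defs.v *)
From mathcomp Require Import all_boot all_order all_algebra.
From mathcomp Require Import complex.
From mathcomp Require Import all_classical all_reals all_analysis.

Set Implicit Arguments.
Unset Strict Implicit.
Unset Printing Implicit Defensive.

Import Order.TTheory GRing.Theory Num.Theory.
Import numFieldNormedType.Exports.

Local Open Scope classical_set_scope.
Local Open Scope ring_scope.

(* A pair type carrying both the Borel sigma-algebra and the normed topology. *)
Notation plane R := (measurableTypeR R * measurableTypeR R)%type.

Definition area (R : realType) : {measure set (plane R) -> \bar R} :=
  (@lebesgue_measure R \x @lebesgue_measure R)%E.

(* The norm of the product normed module is the sup norm, hence the explicit
   Euclidean norm here. *)
Definition disk (R : realType) (r : R) : set (plane R) :=
  [set z | Num.sqrt (z.1 ^+ 2 + z.2 ^+ 2) < r].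

Definition cpow (R : realType) (z : plane R) (j : nat) : plane R :=
  let w := (Complex z.1 z.2 : R[i]) ^+ j in (complex.Re w, complex.Im w).

Definition is_domain (R : realType) (A : set (plane R)) : Prop :=
  [/\ open A, connected A & A !=set0].

(* Partial derivatives: [false] is the first variable, [true] the second. *)
Definition dir (R : realType) (i : bool) : plane R :=
  if i then (0, 1) else (1, 0).

Definition partial (R : realType) (i : bool) (f : plane R -> R) : plane R -> R :=
  fun z => 'D_(dir R i) f z.

(* C^oo: every iterated partial derivative exists and is continuous. *)
Definition smooth (R : realType) (f : plane R -> R) : Prop :=
  forall s : seq bool, let g := foldr (@partial R) f s in
    continuous g /\ forall (i : bool) (z : plane R), derivable g z (dir R i).

Definition test_fun (R : realType) (A : set (plane R)) (f : plane R -> R) : Prop :=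
  smooth f /\
  exists K : set (plane R),
    [/\ compact K, K `<=` A & forall z, ~ K z -> f z = 0].

Definition L2norm (R : realType) (A : set (plane R)) (f : plane R -> R) : \bar R :=
  'N[@area R]_2%:E[EFin \o (f \_ A)].

Definition L2 (R : realType) (A : set (plane R)) (f : plane R -> R) : Prop :=
  measurable_fun A f /\ (L2norm A f < +oo)%E.

(* [G] is a square-integrable weak gradient of [u] on [A]; it is unique up to
   a null set. *)
Definition weak_grad (R : realType) (A : set (plane R)) (u : plane R -> R)
    (G : bool -> plane R -> R) : Prop :=
  forall i : bool, L2 A (G i) /\
    forall phi : plane R -> R, test_fun A phi ->
      \int[@area R]_(z in A) (u z * partial i phi z) =
      - \int[@area R]_(z in A) (G i z * phi z).

Definition grad_norm (R : realType) (A : set (plane R)) (G : bool -> plane R -> R)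
    : \bar R :=
  L2norm A (fun z => Num.sqrt (G false z ^+ 2 + G true z ^+ 2)).

(* H^1_0(A): the H^1-closure of the test functions, its elements being
   everywhere defined representatives extended by zero outside A. *)
Definition H10 (R : realType) (A : set (plane R)) (u : plane R -> R) : Prop :=
  [/\ forall z, ~ A z -> u z = 0,
      L2 A u &
      exists2 G : bool -> plane R -> R, weak_grad A u G &
      exists phi : nat -> plane R -> R,
        [/\ forall n, test_fun A (phi n),
            L2norm A (fun z => phi n z - u z) @[n --> \oo] --> 0%E &
            forall i : bool,
              L2norm A (fun z => partial i (phi n) z - G i z) @[n --> \oo]
                --> 0%E]].

(* Continuous linear functionals on H^1_0(A) normed by the L^2 norm of the
   gradient; boundedness makes [L] invariant under changes on null sets. *)
Definition H10_dual (R : realType) (A : set (plane R))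
    (L : (plane R -> R) -> R) : Prop :=
  (forall (a b : R) (u v : plane R -> R), H10 A u -> H10 A v ->
     L (fun z => a * u z + b * v z) = a * L u + b * L v) /\
  exists C : R, forall (u : plane R -> R) (G : bool -> plane R -> R),
    H10 A u -> weak_grad A u G -> (`|L u|%:E <= C%:E * grad_norm A G)%E.

Definition H10_weakly_to0 (R : realType) (A : set (plane R))
    (v : nat -> plane R -> R) : Prop :=
  (forall k, H10 A (v k)) /\
  forall L : (plane R -> R) -> R, H10_dual A L -> L (v k) @[k --> \oo] --> 0.

Definition gop (R : realType) (j : nat) (zeta : plane R) (u : plane R -> R)
    : plane R -> R :=
  (fun z => (Num.sqrt j%:R)^-1 * u (zeta + cpow z j)) \_ (disk 1).

Definition Dset (R : realType) (A : set (plane R))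
    : set ((plane R -> R) -> plane R -> R) :=
  [set g | exists (j : nat) (zeta : plane R),
     [/\ (0 < j)%N, closure A zeta & g = gop j zeta]].

Definition D_weakly_to0 (R : realType) (A : set (plane R))
    (u : nat -> plane R -> R) : Prop :=
  forall g : nat -> (plane R -> R) -> plane R -> R,
    (forall k, Dset A (g k)) -> H10_weakly_to0 (disk 1) (fun k => g k (u k)).

Definition rearrangement (R : realType) (u : plane R -> R) (t : R) : \bar R :=
  ereal_inf [set s%:E | s in
    [set s : R | 0 < s /\ (area R [set z : plane R | (s < `|u z|)%R] <= t%:E)%E]].

Definition LZnorm (R : realType) (q alpha : R) (u : plane R -> R) : \bar R :=
  ((\int[@lebesgue_measure R]_(t in `]0%R, 1%R[)
      (((ln (expR 1 / t) `^ alpha)%:E * rearrangement u t) `^ q * (t^-1)%:E))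
    `^ q^-1)%E.

(* Main.v *)
From HB Require Import structures.
Require Import Defs.
From mathcomp Require Import all_boot all_order all_algebra.
From mathcomp Require Import complex ring lra.
From mathcomp Require Import all_classical all_reals all_analysis.
From mathcomp Require Import measurable_realfun.
Import Order.TTheory GRing.Theory Num.Theory.
Import numFieldNormedType.Exports.
Local Open Scope classical_set_scope.
Local Open Scope ring_scope.
Set Implicit Arguments.
Unset Strict Implicit.
Unset Printing Implicit Defensive.

(** The counterexample is radial: with s = - ln |x|^2, take a regularization
    of eps * sqrt s, where the truncation scale e^-L and eps^2 ~ 1 / ln L make
    the Dirichlet integral of order 1. Its L^{infty,2;-1} norm is a Hardy
    integral eps^2 * int ds / s and stays away from 0, while
    v(z) = j^(-1/2) u(zeta + z^j) <= eps * (1 + s / j) is small in mean,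
    uniformly in j and zeta.

    Neither the isometry property of the operators nor the size of their
    logarithmic means is obtained by a change of variables: both follow from
    the divergence theorem applied to b(|f|^2) grad |f|^2, f = zeta + z^j, cut
    off where |z|^(2j) lies between 1/4 and 1/2; the boundary term is
    controlled by int_{|z|<1} j^2 |z|^(2j-2) = O(j).

    Boundedness in energy plus convergence to 0 in mean gives weak
    convergence: the Dirichlet product with a fixed test function w is
    - int v (laplacian of w), and a Banach-Saks argument replaces the Riesz
    representation theorem. *)

(** The profile sqrt s is the borderline of Hardy's inequality: its energy and its squared
    L^{infty,2;-1} norm both grow like the integral of ds / s, so one factor [eps2] normalizes both
    and still tends to 0. For j > 1 the map z -> zeta + z^j is j-to-one and branched at 0. The
    pointwise identities |grad |f|^2|^2 = 4 |f|^2 |f'|^2 and laplacian |f|^2 = 4 |f'|^2 hold on all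
    sheets at once, and an upper bound for the energy is all that weak convergence asks for. Adding
    [delta] = e^-L inside the logarithm both truncates it and removes the singularity at the zeros
    of f; the factor e^(-1/a) in [flat] rounds off the end a = 0 of the profile. The domain is the
    disk of radius 1/4: |zeta| <= 1/4 keeps |f| >= 1/4 where |z^j| >= 1/2, a region in which the
    profile has already vanished, and |f| < 1 where |z^j|^2 <= 1/2. Thus the cutoff varies away from
    the zeros of f. *)

(** * A flat function and its derivatives *)

Section Flat.
Context {R : realType}.
Implicit Types p x : R.

(* x^(-p) e^(-1/x) for x > 0: a family closed under differentiation. *)
Definition flat p x : R := if 0 < x then expR (- p * ln x - x^-1) else 0.

Lemma flat_npos p x : x <= 0 -> flat p x = 0.
Proof. by rewrite /flat ltNge => ->. Qed.

Lemma flat_pos p x : 0 < x -> flat p x = expR (- p * ln x - x^-1).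
Proof. by rewrite /flat => ->. Qed.

Lemma flat_ge0 p x : 0 <= flat p x.
Proof. by rewrite /flat; case: ifP => // _; exact: expR_ge0. Qed.

Lemma flat_gt0 p x : 0 < x -> 0 < flat p x.
Proof. by move=> x0; rewrite flat_pos// expR_gt0. Qed.

Lemma flatD p r x : 0 < x -> flat (p + r) x = flat p x * expR (- r * ln x).
Proof. by move=> x0; rewrite !flat_pos// -expRD; congr expR; ring. Qed.

Lemma flatS p x : 0 < x -> flat (p + 1) x = flat p x * x^-1.
Proof. by move=> x0; rewrite flatD// mulN1r expRN lnK. Qed.

Lemma flatSS p x : 0 < x -> flat (p + 2) x = flat p x * x ^- 2.
Proof.
by move=> x0; rewrite (_ : p + 2 = p + 1 + 1); [rewrite !flatS// expr2 invfM mulrA|ring].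
Qed.

(* With m = |p| + 2 and u = 1/x >= 1: ln u <= u/m + ln m, so
   p ln u - u <= m ln m - 2 ln u. *)
Lemma flat_le_sqr p : exists2 M : R, 0 < M & forall x, x <= 1 -> flat p x <= M * x ^+ 2.
Proof.
pose m := `|p| + 2; have m0 : 0 < m by rewrite /m; have := normr_ge0 p; lra.
exists (expR (m * ln m)); first exact: expR_gt0.
move=> x x1; have [x0|x0] := ltP 0 x; last first.
  by rewrite flat_npos// mulr_ge0 ?expR_ge0// sqr_ge0.
rewrite flat_pos//.
have -> : x ^+ 2 = expR (2 * ln x) by rewrite mulr2n mulrDl !mul1r expRD lnK.
rewrite -expRD ler_expR.
have lx : ln x <= 0 by rewrite ln_le0.
have h : - ln x <= (m * x)^-1 + ln m.
  have mx0 : 0 < m * x by rewrite mulr_gt0.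
  have : ln (m * x)^-1 < (m * x)^-1 by apply: ln_sublinear; rewrite invr_gt0.
  rewrite lnV ?posrE// lnM ?posrE//; lra.
have h2 : m * - ln x <= x^-1 + m * ln m.
  have -> : x^-1 + m * ln m = m * ((m * x)^-1 + ln m) by field; rewrite !gt_eqF.
  by rewrite ler_pM2l.
have h3 : - p * ln x <= (m - 2) * - ln x.
  have : p <= m - 2 by rewrite /m addrK ler_norm.
  move=> /ler_wpM2r; rewrite mulNr -mulrN; apply; lra.
lra.
Qed.

(** Only 0 needs care: by [flat_le_sqr] the difference quotient there is at most [M * |h|]. All
    terms vanish for x <= 0, so one formula serves the whole line. *)
Global Instance is_derive_flat p x :
  is_derive x 1 (flat p) (flat (p + 2) x - p * flat (p + 1) x).
Proof.
have [x0|x0|x0] := ltgtP x 0.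
- apply: (@near_eq_is_derive _ _ _ (cst 0)).
    near=> y; rewrite flat_npos// ltW//; near: y.
    by apply: lt_nbhsl.
  by rewrite !flat_npos ?ltW//; apply: is_derive_eq; rewrite mulr0 subr0.
- apply: (@near_eq_is_derive _ _ _ (fun y => expR (- p * ln y - y^-1))).
    near=> y; rewrite flat_pos//; near: y.
    exact: lt_nbhsr.
  have delta : is_derive x 1 (@ln R) x^-1 by exact: is_derive1_ln.
  have dv : is_derive x 1 (fun y : R => y^-1) (- x ^- 2 *: 1).
    by apply: is_deriveV; rewrite gt_eqF.
  have dm : is_derive x 1 (fun y : R => - p * ln y) (- p *: x^-1).
    exact: (is_deriveZ _ _).
  have d1 : is_derive x 1 (fun y : R => - p * ln y - y^-1) (- p *: x^-1 - (- x ^- 2 *: 1)).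
    exact: is_deriveB.
  have d2 := is_derive1_comp (is_derive_expR _) d1.
  apply: (is_derive_eq d2).
  rewrite -flat_pos// flatS// flatSS// /GRing.scale/=; ring.
- rewrite x0 !flat_npos// mulr0 subr0.
  have [M M0 hM] := flat_le_sqr p.
  have h : h^-1 *: ((flat p \o shift 0) (h *: 1) - flat p 0) @[h --> 0^'] --> (0:R).
    rewrite (flat_npos p (lexx 0)).
    have c1 : (M * `|h|) @[h --> (0:R)^'] --> (0:R).
      rewrite -[X in _ --> X](mulr0 M); apply: cvgM; first exact: cvg_cst.
      by rewrite -[X in _ --> X](@normr0 _ R); apply: cvg_norm; apply: cvg_within.
    apply: (@squeeze_cvgr _ _ _ _ (fun h => - (M * `|h|)) (fun h => M * `|h|)) => //; last first.
      by rewrite -[X in _ --> X]oppr0; apply: cvgN.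
    near=> h; rewrite -ler_norml /= subr0 addr0 /GRing.scale/= mulr1.
    have h0 : h != 0 by near: h; exact: nbhs_dnbhs_neq.
    have h1 : h < 1 by near: h; apply: nbhs_dnbhs; exact: lt_nbhsl.
    rewrite normrM normfV ger0_norm ?flat_ge0// mulrC ler_pdivrMr ?normr_gt0//.
    rewrite -mulrA -expr2 real_normK ?num_real//; exact/hM/ltW.
  apply: DeriveDef; first by apply/cvg_ex; exists 0.
  exact/cvg_lim.
Unshelve. all: by end_near. Qed.

End Flat.

(** * Symbolic differentiation of functions on the plane *)

Section Expr.
Context {R : realType}.

(** Reified functions: continuity, smoothness and derivatives are read off the syntax. [D] stays
    inside it because the derivative of [Flat p] combines [Flat (p + 1)] and [Flat (p + 2)]. *)
Inductive expr :=
  | Cst of R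
  | Coord of bool
  | Add of expr & expr
  | Mul of expr & expr
  | Flat of R & expr
  | Recip of expr
  | Ln of expr.

Fixpoint ev (e : expr) (z : plane R) : R :=
  match e with
  | Cst r => r
  | Coord i => if i then z.2 else z.1
  | Add a b => ev a z + ev b z
  | Mul a b => ev a z * ev b z
  | Flat p a => flat p (ev a z)
  | Recip a => (ev a z)^-1
  | Ln a => ln (ev a z)
  end.

Fixpoint wf (e : expr) : Prop :=
  match e with
  | Cst _ | Coord _ => True
  | Add a b | Mul a b => wf a /\ wf b
  | Flat _ a => wf a
  | Recip a | Ln a => wf a /\ forall z, 0 < ev a z
  end.

Fixpoint D (i : bool) (e : expr) : expr :=
  match e with
  | Cst _ => Cst 0
  | Coord k => Cst (i == k)%:R
  | Add a b => Add (D i a) (D i b)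
  | Mul a b => Add (Mul (D i a) b) (Mul a (D i b))
  | Flat p a => Mul (Add (Flat (p + 2) a) (Mul (Cst (- p)) (Flat (p + 1) a))) (D i a)
  | Recip a => Mul (Mul (Cst (-1)) (Mul (Recip a) (Recip a))) (D i a)
  | Ln a => Mul (Recip a) (D i a)
  end.

Lemma wf_D i e : wf e -> wf (D i e).
Proof. by elim: e => //=; intuition. Qed.

Lemma comp_deriv (f : plane R -> R) (g : R -> R) z dg :
  differentiable f z -> is_derive (f z) 1 g dg ->
  differentiable (fun z => g (f z)) z /\
  forall v, 'D_v (fun z => g (f z)) z = dg * 'D_v f z.
Proof.
move=> df [dg1 dg2].
have dg' : differentiable g (f z) by apply/derivable1_diffP.
have h : differentiable (g \o f) z by apply: differentiable_comp.
split=> // v.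
rewrite -[fun z => g (f z)]/(g \o f) deriveE// diff_comp//= deriv1E//.
by rewrite derive1E dg2 -deriveE// mulrC.
Qed.

Lemma eval_deriv e z : wf e ->
  differentiable (ev e) z /\
  forall i, 'D_(dir R i) (ev e) z = ev (D i e) z.
Proof.
elim: e => [r|k|a iha b ihb|a iha b ihb|p a iha|a iha|a iha] /=.
- move=> _; split; first exact: differentiable_cst.
  by move=> i; rewrite derive_cst.
- move=> _; case: k.
    have l : linear (fun z : plane R => (z.2 : R)) by [].
    pose L := GRing.isLinear.Build _ _ _ _ _ l.
    pose f : {linear plane R -> R} := HB.pack (fun z : plane R => (z.2 : R)) L.
    have df : differentiable f z by apply: linear_differentiable; move=> w; exact: cvg_snd.
    split; first exact: df.
    move=> i; rewrite -/(f : plane R -> R) deriveE//.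
  rewrite -[LHS]/('d f z (dir R i)) diff_lin; last by move=> w; exact: cvg_snd.
    by case: i.
  have l : linear (fun z : plane R => (z.1 : R)) by [].
  pose L := GRing.isLinear.Build _ _ _ _ _ l.
  pose f : {linear plane R -> R} := HB.pack (fun z : plane R => (z.1 : R)) L.
  have df : differentiable f z by apply: linear_differentiable; move=> w; exact: cvg_fst.
  split; first exact: df.
  move=> i; rewrite -/(f : plane R -> R) deriveE//.
  rewrite -[LHS]/('d f z (dir R i)) diff_lin; last by move=> w; exact: cvg_fst.
  by case: i.
- move=> [/iha[da Da] /ihb[db Db]]; split; first exact: differentiableD.
  by move=> i; rewrite deriveD ?Da ?Db//; exact: diff_derivable.
- move=> [/iha[da Da] /ihb[db Db]]; split; first exact: differentiableM.
  by move=> i; rewrite deriveM ?Da ?Db; [rewrite /GRing.scale/=; ring|exact: diff_derivable..].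
- move=> /iha[da Da]; have [h1 h2] := comp_deriv da (is_derive_flat p (ev a z)).
  by split=> // i; rewrite h2 Da mulNr.
- move=> [/iha[da Da] /(_ z) a0].
  have d : is_derive (ev a z) 1 (fun y : R => y^-1) (- (ev a z) ^- 2 *: 1).
    by apply: is_deriveV; rewrite gt_eqF.
  have [h1 h2] := comp_deriv da d.
  by split=> // i; rewrite h2 Da /GRing.scale/= mulr1 mulN1r expr2 invfM.
- move=> [/iha[da Da] /(_ z) a0].
  have [h1 h2] := comp_deriv da (is_derive1_ln a0).
  by split=> // i; rewrite h2 Da.
Qed.

Lemma partial_eval i e : wf e -> partial i (ev e) = ev (D i e).
Proof. by move=> we; apply/funext => z; rewrite /partial (eval_deriv z we).2. Qed.

Lemma continuous_eval e : wf e -> continuous (ev e).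
Proof. by move=> we z; apply: differentiable_continuous; have [] := eval_deriv z we. Qed.

Lemma derivable_eval e z v : wf e -> derivable (ev e) z v.
Proof. by move=> we; apply: diff_derivable; have [] := eval_deriv z we. Qed.

Lemma smooth_eval e : wf e -> smooth (ev e).
Proof.
move=> we s; have [e' [we' ->]] : exists e', wf e' /\ foldr (@partial R) (ev e) s = ev e'.
  elim: s => [|i s [e' [we' IH]]] /=; first by exists e.
  by exists (D i e'); split; [exact: wf_D|rewrite IH partial_eval].
by split; [exact: continuous_eval|move=> i z; exact: derivable_eval].
Qed.

End Expr.

(** * Divergence theorem for compactly supported functions *)

Section PlaneIntegral.
Context {R : realType}.
Local Notation mu := (@lebesgue_measure R).

(** Balls of the sup norm are products of intervals, and every open set is a countable union of
    those with rational centre and radius 1 / (n + 1). *)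
Lemma open_measurable_plane (U : set (plane R)) : open U -> measurable U.
Proof.
move=> oU.
pose B (p : rat * rat * nat) : set (plane R) :=
  (ball (ratr p.1.1 : R) (p.2.+1%:R^-1 : R)) `*` (ball (ratr p.1.2 : R) (p.2.+1%:R^-1 : R)).
have mB p : measurable (B p) by apply: measurableX; exact: measurable_ball.
pose F p := if `[< B p `<=` U >] then B p else set0.
suff -> : U = \bigcup_p F p.
  apply: countable_bigcupT_measurable; first exact: countableP.
  by move=> p; rewrite /F; case: ifP.
apply/seteqP; split=> [z Uz|z [p _]]; last first.
  by rewrite /F; case: asboolP => // + Bz; exact.
have /nbhs_ballP[e /= e0 he] : nbhs z U by apply: open_nbhs_nbhs.
(* Half of [e]: one radius for the distance from z to the rational centre, one for the ball
   itself. *)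
have [n hn] : exists n : nat, (n.+1%:R^-1 : R) < e / 2.
  exists (Num.truncn (e / 2)^-1); rewrite invf_plt ?posrE ?divr_gt0// ?ltr0n//.
  exact: truncnS_gt.
have n0 : (0 : R) < n.+1%:R^-1 by rewrite invr_gt0 ltr0n.
have hr (x c : R) : 0 < c -> exists p : rat, x - c < ratr p < x + c.
  move=> c0; have [|p] := @rat_in_itvoo R (x - c) (x + c); first by lra.
  by rewrite in_itv/= => h; exists p.
have [p /andP[p1 p2]] := hr z.1 _ n0; have [q /andP[q1 q2]] := hr z.2 _ n0.
exists (p, q, n) => //; rewrite /F asboolT /B.
    move: p1 p2 q1 q2; set c := _^-1 => p1 p2 q1 q2.
  by split; rewrite /ball/= ltr_norml; apply/andP; split; lra.
move=> w [/= ]; rewrite /ball/= => /ltr_normlP[w1 w2] /ltr_normlP[w3 w4].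
apply: he; move: p1 p2 q1 q2 hn w1 w2 w3 w4; set c := n.+1%:R^-1 => p1 p2 q1 q2 hn w1 w2 w3 w4; split; rewrite /ball/= ltr_norml; apply/andP; split; lra.
Qed.

Lemma continuous_measurable_plane (f : plane R -> R) : continuous f -> measurable_fun setT f.
Proof.
move=> cf; apply: (measurability _ (RGenOpens.measurableE R)) => _ [_ [a [b ->] <-]].
rewrite setTI; apply: open_measurable_plane.
by apply: open_comp; [move=> z _; exact: cf|exact: interval_open].
Qed.

Definition sq (r : R) : set (plane R) := `[- r, r] `*` `[- r, r].

Definition supp_in (r : R) (f : plane R -> R) := forall z, ~ sq r z -> f z = 0.

Lemma measurable_sq r : measurable (sq r).
Proof. by apply: measurableX; exact: measurable_itv. Qed.

Lemma compact_sq r : compact (sq r).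
Proof. by apply: compact_setX; exact: segment_compact. Qed.

Lemma closed_sq r : closed (sq r).
Proof. by apply: compact_closed (@compact_sq r); exact: norm_hausdorff. Qed.

Lemma area_sq (r : R) : 0 <= r -> area R (sq r) = (4 * r ^+ 2)%:E.
Proof.
move=> r0; pose I : set R := `[- r, r]%classic; have -> : area R (sq r) = (mu I * mu I)%E.
  by apply: product_measure1E; exact: measurable_itv.
rewrite /I lebesgue_measure_itv/= lte_fin; case: ltP => h.
  by rewrite -EFinB -EFinM; congr EFin; ring.
have -> : r = 0 by lra.
by rewrite mule0 expr0n/= mulr0.
Qed.

Lemma integrable_supp r (f : plane R -> R) (M : R) :
  measurable_fun setT f -> supp_in r f -> (forall z, `|f z| <= M) ->
  (area R).-integrable setT (EFin \o f).
Proof.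
move=> mf sf bf.
have -> : EFin \o f = (EFin \o f) \_ (sq r).
  apply/funext => z; rewrite patchE; case: ifPn => //.
  by rewrite notin_setE => /sf /= ->.
apply/integrable_restrict => //; first exact: measurable_sq.
rewrite setTI; apply: measurable_bounded_integrable.
- exact: measurable_sq.
- have [r0|r0] := leP 0 r; first by rewrite area_sq// ltry.
  rewrite (_ : sq r = set0) ?measure0//; apply/seteqP; split=> // z [/= + _].
  by rewrite in_itv/= => /andP[]; lra.
- exact: measurable_funTS.
- by exists M; split; [exact: num_real|move=> x Mx z _ /=; exact: le_trans (bf z) (ltW Mx)].
Qed.

Lemma continuous_supp_bounded r (f : plane R -> R) : continuous f -> supp_in r f ->
  exists2 M : R, 0 <= M & forall z, `|f z| <= M.
Proof.
move=> cf sf.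
have [|n0] := pselect (sq r !=set0); last first.
  by exists 0 => // z; rewrite sf ?normr0// => h; apply: n0; exists z.
move=> n0; have [|c _ hc] := compact_EVT_max (f := fun z => `|f z|) n0 (@compact_sq r).
  by apply: continuous_subspaceT => z; apply: cvg_norm; exact: cf.
exists `|f c| => // z; have [h|h] := pselect (sq r z); first by apply: hc; rewrite inE.
by rewrite sf ?normr0.
Qed.

Lemma integrable_csupp r (f : plane R -> R) : continuous f -> supp_in r f ->
  (area R).-integrable setT (EFin \o f).
Proof.
move=> cf sf; have [M _ hM] := continuous_supp_bounded cf sf.
by apply: integrable_supp sf hM; exact: continuous_measurable_plane.
Qed.

Lemma supp_derive r (f : plane R -> R) v : supp_in r f -> supp_in r (fun z => 'D_v f z).
Proof.
move=> sf z hz; rewrite (@near_eq_derive _ _ _ f (cst 0)) ?derive_cst//.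
have : nbhs z (~` sq r).
  by apply: open_nbhs_nbhs; split=> //; apply: closed_openC; exact: closed_sq.
by apply: filterS => w /sf.
Qed.

Lemma FTC_csupp (r : R) (f g : R -> R) : 0 < r -> (forall x : R, is_derive x 1 f (g x)) -> continuous g ->
  (forall x : R, r <= `|x| -> f x = 0) -> (forall x : R, r < `|x| -> g x = 0) ->
  (\int[mu]_x (g x)%:E = 0)%E.
Proof.
move=> r0 df cg f0 g0.
rewrite (_ : (fun x => (g x)%:E) = ((EFin \o g) \_ `[-r, r])); last first.
  apply/funext => x; rewrite patchE; case: ifPn => //; rewrite notin_setE /= in_itv/= => h.
  by rewrite g0// ltNge ler_norml; apply/negP.
rewrite -integral_mkcond (@continuous_FTC2 _ g f); last 4 first.
- by lra.
- by apply: continuous_subspaceT.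
- have cf x : {for x, continuous f}.
    by apply/differentiable_continuous/derivable1_diffP; exact: ex_derive.
  split; [by move=> x _; exact: ex_derive| |].
    by apply: cvg_at_right_filter; exact: cf.
  by apply: cvg_at_left_filter; exact: cf.
- by move=> x _; rewrite derive1E derive_val.
by rewrite !f0 ?normrN ?ger0_norm ?subee// ltW.
Qed.

(** Fubini with the differentiated variable innermost: each inner integral is that of the derivative
    of a compactly supported function of one variable. *)
Lemma green (r : R) (f : plane R -> R) i : 0 < r -> (forall z, derivable f z (dir R i)) ->
  continuous (partial i f) -> continuous f -> supp_in r f ->
  \int[area R]_z partial i f z = 0.
Proof.
move=> r0 df cdf cf sf.
have sd : supp_in r (partial i f) by exact: supp_derive.
have ig := integrable_csupp cdf sd.
have sqP a b : sq r (a, b) -> `|a| <= r /\ `|b| <= r.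
  by case=> /=; rewrite !in_itv/= -!ler_norml.
(* [FTC_csupp] wants f to vanish at the endpoints, whereas [supp_in r] speaks only of points outside
   the closed square; hence r + 1. *)
have rr : 0 < r + 1 by lra.
rewrite /Rintegral; case: i df cdf sd ig => df cdf sd ig.
  rewrite -(integral12_prod_meas1 ig)/=.
  rewrite (_ : (fun x => _) = cst 0%E) ?integral0//; apply/funext => x; rewrite /fubini_F/=.
  apply: (@FTC_csupp (r + 1) (fun y => f (x, y))) => //.
  - move=> y; have -> : (fun y => f (x, y)) = (fun h => f (x, h)) by [].
    have E : (fun h : R => h^-1 *: (((fun y => f (x, y)) \o shift y) (h *: 1) - f (x, y))) =
             (fun h : R => h^-1 *: ((f \o shift ((x, y) : plane R)) (h *: dir R true) - f (x, y))).
      apply/funext => h /=; congr (_ *: (f _ - _)).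
      by apply: injective_projections; [rewrite -[RHS]/(h * 0 + x) mulr0 add0r|].
    split; first by rewrite /derivable E; exact: df.
    by rewrite /derive E.
  - move=> y; apply: (@continuous_comp _ _ _ (fun y : R => (x, y) : plane R) (partial true f)); last exact: cdf.
    by apply: (@cvg_pair _ _ _ _ (nbhs (x : R)) (nbhs (y : R))); [exact: cvg_cst|exact: cvg_id].
  - by move=> y hy; apply: sf => /sqP[_]; lra.
  - by move=> y hy; apply: sd => /sqP[_]; lra.
rewrite -(integral21_prod_meas1 ig)/=.
rewrite (_ : (fun x => _) = cst 0%E) ?integral0//; apply/funext => y; rewrite /fubini_G/=.
apply: (@FTC_csupp (r + 1) (fun x => f (x, y))) => //.
- move=> x.
  have E : (fun h : R => h^-1 *: (((fun x => f (x, y)) \o shift x) (h *: 1) - f (x, y))) =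
           (fun h : R => h^-1 *: ((f \o shift ((x, y) : plane R)) (h *: dir R false) - f (x, y))).
    apply/funext => h /=; congr (_ *: (f _ - _)).
    by apply: injective_projections; [|rewrite -[RHS]/(h * 0 + y) mulr0 add0r].
  split; first by rewrite /derivable E; exact: df.
  by rewrite /derive E.
- move=> x; apply: (@continuous_comp _ _ _ (fun x : R => (x, y) : plane R) (partial false f)); last exact: cdf.
  by apply: (@cvg_pair _ _ _ _ (nbhs (x : R)) (nbhs (y : R))); [exact: cvg_id|exact: cvg_cst].
- by move=> x hx; apply: sf => /sqP[]; lra.
- by move=> x hx; apply: sd => /sqP[]; lra.
Qed.

End PlaneIntegral.

(** * Test functions as elements of H^1_0 *)

Section Nice.
Context {R : realType}.

Definition intg (f : plane R -> R) : R := \int[area R]_z f z.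

(** One square for all functions: with half side 2 it contains |z|^2 <= 4, hence the unit disk and
    the supports of the cutoffs used below. *)
Definition csupp (f : plane R -> R) := continuous f /\ supp_in 2 f.

Lemma csupp_integrable f : csupp f -> (area R).-integrable setT (EFin \o f).
Proof. by case=> cf sf; exact: integrable_csupp sf. Qed.

Lemma csuppD f g : csupp f -> csupp g -> csupp (fun z => f z + g z).
Proof.
move=> [cf sf] [cg sg]; split=> [z|z hz]; last by rewrite sf// sg// addr0.
by apply: cvgD; [exact: cf|exact: cg].
Qed.

Lemma csuppMl f g : csupp f -> continuous g -> csupp (fun z => f z * g z).
Proof.
move=> [cf sf] cg; split=> [z|z hz]; last by rewrite sf// mul0r.
by apply: cvgM; [exact: cf|exact: cg].
Qed.

Lemma csuppZ c f : csupp f -> csupp (fun z => c * f z).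
Proof.
move=> [cf sf]; split=> [z|z hz]; last by rewrite sf// mulr0.
by apply: cvgM; [exact: cvg_cst|exact: cf].
Qed.

Lemma intgD f g : csupp f -> csupp g -> intg (fun z => f z + g z) = intg f + intg g.
Proof. by move=> sf sg; apply: RintegralD => //; exact: csupp_integrable. Qed.

Lemma intgZ c f : csupp f -> intg (fun z => c * f z) = c * intg f.
Proof. by move=> sf; apply: RintegralZl => //; exact: csupp_integrable. Qed.

Lemma le_intg f g : csupp f -> csupp g -> (forall z, f z <= g z) -> intg f <= intg g.
Proof. by move=> sf sg fg; apply: le_Rintegral => //; exact: csupp_integrable. Qed.

Lemma intg_ge0 f : (forall z, 0 <= f z) -> 0 <= intg f.
Proof. by move=> f0; apply: Rintegral_ge0 => z _; exact: f0. Qed.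

Lemma intg_sqr_ge0 f : 0 <= intg (fun z => f z ^+ 2).
Proof. by apply: intg_ge0 => z; exact: sqr_ge0. Qed.

Lemma intg_div (e0 e1 : @expr R) : wf e0 -> wf e1 ->
  supp_in 2 (ev e0) -> supp_in 2 (ev e1) ->
  csupp (fun z => ev (D false e0) z + ev (D true e1) z) /\
  intg (fun z => ev (D false e0) z + ev (D true e1) z) = 0.
Proof.
move=> w0 w1 s0 s1.
have h i e : wf e -> supp_in 2 (ev e) -> csupp (ev (D i e)) /\ intg (ev (D i e)) = 0.
  move=> we se.
  have c : csupp (ev (D i e)).
    split; first exact/continuous_eval/wf_D.
    by rewrite -partial_eval//; exact: supp_derive.
  split=> //; rewrite -partial_eval//; apply: (@green _ 2) => //.
  - by move=> z; exact: derivable_eval.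
  - by rewrite partial_eval//; exact/continuous_eval/wf_D.
  - exact: continuous_eval.
have [c0 i0] := h false e0 w0 s0; have [c1 i1] := h true e1 w1 s1.
by split; [exact: csuppD|rewrite intgD// i0 i1 addr0].
Qed.

Definition nrm2 (z : plane R) : R := (z.1 : R) ^+ 2 + (z.2 : R) ^+ 2.

Lemma sq_nrm2 (z : plane R) : ~ sq 2 z -> 4 < nrm2 z.
Proof.
case: z => x y; rewrite /sq /nrm2 /= => h; rewrite ltNge; apply/negP => h4; apply: h.
have x2 := sqr_ge0 (x : R); have y2 := sqr_ge0 (y : R).
have b (t : R) : t ^+ 2 <= 4 -> t \in `[-2, 2].
  move=> ht; rewrite in_itv/= -ler_norml -(ler_pXn2r (n := 2)) ?nnegrE//.
  by rewrite real_normK ?num_real//; lra.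
by split; apply: b; lra.
Qed.

Lemma diskE (r : R) z : 0 < r -> disk r z <-> nrm2 z < r ^+ 2.
Proof.
move=> r0; rewrite /disk/=; split.
  move=> h; rewrite -[ltLHS]sqr_sqrtr ?addr_ge0 ?sqr_ge0//.
  by rewrite ltr_pXn2r ?nnegrE ?sqrtr_ge0// ltW.
by move=> h; rewrite -(ltr_pXn2r (n := 2)) ?nnegrE ?sqrtr_ge0 ?ltW// sqr_sqrtr// addr_ge0 ?sqr_ge0.
Qed.

Lemma disk1_sq (A : set (plane R)) : A `<=` disk 1 -> forall z, ~ sq 2 z -> ~ A z.
Proof.
move=> A1 z /sq_nrm2 h /A1; rewrite diskE// expr1n; lra.
Qed.

Lemma nrm2_eval : nrm2 = ev (Add (Mul (Coord false) (Coord false)) (Mul (Coord true) (Coord true))).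
Proof. by apply/funext => z; rewrite /nrm2 !expr2. Qed.

Lemma continuous_nrm2 : continuous nrm2.
Proof. by rewrite nrm2_eval; apply: continuous_eval. Qed.

Lemma open_disk (r : R) : 0 < r -> open (disk r).
Proof.
move=> r0; rewrite (_ : disk r = nrm2 @^-1` [set t | t < r ^+ 2]); last first.
  by apply/seteqP; split=> z /diskE; exact.
by apply: open_comp; [move=> z _; exact: continuous_nrm2|exact: open_lt].
Qed.

Definition nice (A : set (plane R)) (e : expr) :=
  wf e /\ exists K : set (plane R), [/\ compact K, K `<=` A & forall z, ~ K z -> ev e z = 0].

Lemma nice_add A a b : nice A a -> nice A b -> nice A (Add a b).
Proof.
move=> [wa [K [cK KA aK]]] [wb [K' [cK' KA' bK]]]; split=> //.
exists (K `|` K'); split; first exact: compactU.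
- by move=> z [/KA|/KA'].
- by move=> z /= hz; rewrite aK ?bK ?addr0// => h; apply: hz; [right|left].
Qed.

Lemma nice_scale A c a : nice A a -> nice A (Mul (Cst c) a).
Proof.
move=> [wa [K [cK KA aK]]]; split=> //.
by exists K; split=> // z hz /=; rewrite aK// mulr0.
Qed.

Definition dirip (a b : @expr R) : R := intg (fun z =>
  ev (D false a) z * ev (D false b) z + ev (D true a) z * ev (D true b) z).

Section Domain.
Variable A : set (plane R).
Hypothesis (A1 : A `<=` disk 1).

Lemma nice_test e : nice A e -> test_fun A (ev e).
Proof. by move=> [we hK]; split=> //; exact: smooth_eval. Qed.

Lemma nice_supp e : nice A e -> supp_in 2 (ev e).
Proof. by move=> [we [K [_ KA eK]]] z hz; apply: eK => /KA; exact: disk1_sq. Qed.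

Lemma nice_csupp e : nice A e -> csupp (ev e).
Proof. by move=> ne; split; [apply: continuous_eval; case: ne|exact: nice_supp]. Qed.

Lemma nice_csuppD i e : nice A e -> csupp (ev (D i e)).
Proof.
move=> ne; have we := ne.1; split; first exact/continuous_eval/wf_D.
by rewrite -partial_eval//; apply: supp_derive; exact: nice_supp.
Qed.

Lemma nice_D0 i e z : nice A e -> ~ A z -> ev (D i e) z = 0.
Proof.
move=> [we [K [cK KA eK]]] nAz; rewrite -partial_eval// /partial.
rewrite (@near_eq_derive _ _ _ _ (cst 0)) ?derive_cst//.
have : nbhs z (~` K).
  apply: open_nbhs_nbhs; split; last by move=> /KA.
  by apply: closed_openC; apply: compact_closed cK; exact: norm_hausdorff.
by apply: filterS => w /eK.
Qed.

Lemma L2norm_csupp (f : plane R -> R) : csupp f -> (forall z, ~ A z -> f z = 0) ->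
  L2norm A f = (Num.sqrt (intg (fun z => f z ^+ 2)))%:E.
Proof.
move=> cf f0; rewrite /L2norm (_ : f \_ A = f); last first.
  by apply/funext => z; rewrite patchE; case: ifPn => //; rewrite notin_setE => /f0.
rewrite unlock/= (_ : (fun x => _) = (EFin \o (fun z => (f z ^+ 2)%R))); last first.
  by apply/funext => z /=; rewrite powR_mulrn// real_normK ?num_real.
have hi : (area R).-integrable setT (EFin \o (fun z => (f z ^+ 2)%R)).
  rewrite (_ : (fun z => _) = (fun z => f z * f z)).
    by apply: csupp_integrable; apply: csuppMl => //; case: cf.
  by apply/funext => z; rewrite expr2.
have -> : (\int[area R]_x (EFin \o (fun z => (f z ^+ 2)%R)) x = (intg (fun z => (f z ^+ 2)%R))%:E)%E.
  by rewrite /intg /Rintegral fineK//; exact: integrable_fin_num hi.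
by rewrite poweR_EFin powR12_sqrt// intg_sqr_ge0.
Qed.

(** The product with a test function has compact support, so [green] applies to its partial
    derivative. The test function is arbitrary, not an expression, hence the product rule at the
    level of functions. *)
Lemma nice_weak_grad e : nice A e -> weak_grad A (ev e) (fun i => ev (D i e)).
Proof.
move=> ne i; have cD := nice_csuppD i ne; split.
  split; first by apply: measurable_funTS; apply: continuous_measurable_plane; case: cD.
  by rewrite L2norm_csupp// ?ltry// => z; exact: nice_D0.
move=> phi [sphi [K [cK KA phiK]]].
have [cphi dphi] := sphi [::]; have [cp _] := sphi [:: i]; rewrite /= in cphi cp dphi.
have e0 z : ~ A z -> ev e z = 0.
  by move=> nz; case: ne => _ [K' [_ K'A eK]]; apply: eK => /K'A.
have ce := nice_csupp ne.
rewrite Rintegral_mkcond [X in _ = - X]Rintegral_mkcond.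
rewrite (_ : _ \_ A = (fun z => ev e z * partial i phi z)); last first.
  by apply/funext => z; rewrite patchE; case: ifPn => //; rewrite notin_setE => /e0 ->; rewrite mul0r.
rewrite [in RHS](_ : _ \_ A = (fun z => ev (D i e) z * phi z)); last first.
  by apply/funext => z; rewrite patchE; case: ifPn => //; rewrite notin_setE => /(nice_D0 i ne) ->; rewrite mul0r.
apply/eqP; rewrite -addr_eq0 -!/(intg _) -intgD; [|exact: csuppMl..].
apply/eqP.
have E : (fun z => ev e z * partial i phi z + ev (D i e) z * phi z) =
         partial i (fun z => ev e z * phi z).
  apply/funext => z; rewrite /partial deriveM; [|by apply: derivable_eval; case: ne|exact: dphi].
  rewrite -[in LHS]partial_eval; last by case: ne.
  by rewrite /partial /GRing.scale/= [in RHS]mulrC; congr +%R; rewrite mulrC.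
rewrite E; apply: (@green _ 2) => //.
- by move=> z; apply: derivableM; [apply: derivable_eval; case: ne|exact: dphi].
- by rewrite -E; have [] := csuppD (csuppMl ce cp) (csuppMl cD cphi).
- by have [] := csuppMl ce cphi.
- by have [] := csuppMl ce cphi.
Qed.

Lemma nice_grad_norm e : nice A e ->
  grad_norm A (fun i => ev (D i e)) = (Num.sqrt (dirip e e))%:E.
Proof.
move=> ne; have c0 := nice_csuppD false ne; have c1 := nice_csuppD true ne.
pose g z := ev (D false e) z ^+ 2 + ev (D true e) z ^+ 2.
have g0 z : 0 <= g z by rewrite addr_ge0 ?sqr_ge0.
have cg : csupp g.
  have -> : g = (fun z => ev (D false e) z * ev (D false e) z + ev (D true e) z * ev (D true e) z).
    by apply/funext => z; rewrite /g !expr2.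
  by apply: csuppD; apply: csuppMl => //; [case: c0|case: c1].
rewrite /grad_norm L2norm_csupp.
- congr (Num.sqrt _)%:E; rewrite /dirip /intg; apply: eq_Rintegral => z _.
  by rewrite sqr_sqrtr ?g0// !expr2.
- split=> [z|z hz]; last by rewrite -/(g z) cg.2// sqrtr0.
  apply: (@continuous_comp _ _ _ g Num.sqrt); last exact: sqrt_continuous.
  by case: cg => + _; exact.
- by move=> z nz; rewrite !(nice_D0 _ ne nz) expr0n/= addr0 sqrtr0.
Qed.

Lemma nice_H10 e : nice A e -> H10 A (ev e).
Proof.
move=> ne; have e0 z : ~ A z -> ev e z = 0.
  by move=> nz; case: ne => _ [K' [_ K'A eK]]; apply: eK => /K'A.
have ce := nice_csupp ne.
have Z : L2norm A (cst 0 : plane R -> R) = 0%E.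
  rewrite /L2norm (_ : _ \o _ = cst 0%E) ?Lnorm0//.
  by apply/funext => z /=; rewrite patchE; case: ifP.
split=> //.
  split; first by apply: measurable_funTS; apply: continuous_measurable_plane; case: ce.
  by rewrite L2norm_csupp// ltry.
exists (fun i => ev (D i e)); first exact: nice_weak_grad.
(* [ev e] is itself a test function, so a constant sequence approximates it. *)
exists (fun=> ev e); split.
- by move=> _; exact: nice_test.
- rewrite (_ : (fun z => ev e z - ev e z) = cst 0) ?Z; first exact: cvg_cst.
  by apply/funext => z; rewrite subrr.
- move=> i; rewrite (_ : (fun z => partial i (ev e) z - ev (D i e) z) = cst 0) ?Z; first exact: cvg_cst.
  by apply/funext => z; rewrite partial_eval ?subrr//; case: ne.
Qed.

End Domain.
End Nice.

(** * A criterion for weak convergence *)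

Section Weak.
Context {R : realType}.
Variable A : set (plane R).
Hypothesis (A1 : A `<=` disk 1).

Lemma dirip_csupp (a b : expr) : nice A a -> nice A b ->
  csupp (fun z => ev (D false a) z * ev (D false b) z + ev (D true a) z * ev (D true b) z).
Proof.
move=> na nb; apply: csuppD; apply: csuppMl; try exact: (nice_csuppD A1).
  by case: (nice_csuppD A1 false nb).
by case: (nice_csuppD A1 true nb).
Qed.

Lemma dirip_addl (w v : expr) s : nice A w -> nice A v ->
  let w' := Add w (Mul (Cst s) v) in
  dirip w' w' = dirip w w + (2 * s * dirip w v + s ^+ 2 * dirip v v).
Proof.
move=> nw nv w'; have cww := dirip_csupp nw nw.
have cwv := csuppZ (2 * s) (dirip_csupp nw nv); have cvv := csuppZ (s ^+ 2) (dirip_csupp nv nv).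
rewrite /dirip -(intgZ _ (dirip_csupp nw nv)) -(intgZ _ (dirip_csupp nv nv)) -(intgD cwv cvv).
rewrite -(intgD cww (csuppD cwv cvv)).
by congr intg; apply/funext => z /=; ring.
Qed.

Lemma dirip_ge0 (e : @expr R) : 0 <= dirip e e.
Proof. by apply: intg_ge0 => z; rewrite -!expr2 addr_ge0 ?sqr_ge0. Qed.

(* A bounded sequence whose Dirichlet products with every fixed test function
   vanish in the limit contains, if |L| stays >= d along a subsequence, sums of
   n almost orthogonal terms: L is >= n d on them and the energy is O(n). *)
Lemma nice_weakly_to0 (e : nat -> expr) (M : R) :
  (forall k, nice A (e k)) -> (forall k, dirip (e k) (e k) <= M) ->
  (forall w, nice A w -> dirip w (e k) @[k --> \oo] --> 0) ->
  H10_weakly_to0 A (fun k => ev (e k)).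
Proof.
move=> ne eM ew; split; first by move=> k; exact: (nice_H10 A1).
move=> L [Llin [C LC]].
have M0 : 0 <= M by exact: le_trans (dirip_ge0 (e 0)) (eM 0).
have LD (a b : expr) s : nice A a -> nice A b ->
    L (ev (Add a (Mul (Cst s) b))) = L (ev a) + s * L (ev b).
  move=> na nb; rewrite -[in RHS](mul1r (L (ev a))) -Llin; try exact: (nice_H10 A1).
  by congr L; apply/funext => z /=; rewrite mul1r.
have n0 : nice A (Cst 0).
  by split=> //; exists set0; split => //; exact: compact0.
have L0 : L (ev (Cst 0)) = 0.
  rewrite -[RHS](mul0r (L (ev (Cst 0)))) -[RHS]addr0 -[X in _ = _ + X](mul0r (L (ev (Cst 0)))).
  rewrite -Llin; try exact: (nice_H10 A1).
  by congr L; apply/funext => z /=; rewrite !mul0r addr0.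
have Lb w : nice A w -> L (ev w) <= `|C| * Num.sqrt (dirip w w).
  move=> nw; apply: le_trans (ler_norm _) _.
  have := LC _ _ (nice_H10 A1 nw) (nice_weak_grad A1 nw).
  rewrite (nice_grad_norm A1 nw) -EFinM lee_fin => /le_trans; apply.
  by apply: ler_wpM2r (ler_norm _); exact: sqrtr_ge0.
apply/cvgrPdist_lt => d d0; apply: contrapT => far.
have often N : exists2 k, (N <= k)%N & d <= `|L (ev (e k))|.
  apply: contrapT => h; apply: far; exists N => //= k Nk.
  by rewrite sub0r normrN ltNge; apply/negP => dk; apply: h; exists k.
have build n : exists2 w, nice A w & n%:R * d <= L (ev w) /\ dirip w w <= n%:R * (M + 1).
  elim: n => [|n [w nw [Lw ww]]].
    exists (Cst 0) => //; rewrite L0 !mul0r; split=> //.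
    rewrite /dirip le_eqVlt; apply/orP; left; apply/eqP; rewrite /intg /Rintegral.
    by under eq_integral do rewrite /= mul0r addr0; rewrite integral0.
  (* A Dirichlet product below 1/2 makes the cross term [2 * s * dirip w (e k)] at most 1, so the
     energy grows by at most M + 1. *)
  have /cvgrPdist_lt/(_ 2^-1 ltac:(lra)) [N _ hN] := ew w nw.
  have [k Nk dk] := often N; have := hN k Nk; rewrite /= sub0r normrN => wk.
  pose s : R := Num.sg (L (ev (e k))).
  have s1 : `|s| = 1.
    rewrite /s normr_sg; case: eqP => [h|//].
    by move: dk; rewrite h normr0; lra.
  have s2 : s ^+ 2 = 1 by rewrite -[LHS]real_normK ?num_real// s1 expr1n.
  exists (Add w (Mul (Cst s) (e k))); first by apply: nice_add => //; exact: nice_scale.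
  rewrite LD// dirip_addl// s2 mul1r -natr1 !mulrDl !mul1r; split.
    by apply: lerD => //; rewrite /s -normrEsg.
  have h : 2 * s * dirip w (e k) <= 1.
    apply: le_trans (ler_norm _) _; rewrite !normrM s1 mulr1 ger0_norm//; lra.
  have := eM k; lra.
(* From n d <= |C| sqrt (n (M + 1)) follows n d^2 <= C^2 (M + 1), which this n violates. *)
pose n := (Num.truncn (C ^+ 2 * (M + 1) / d ^+ 2)).+1.
have [w nw [Lw ww]] := build n.
have n1 : 0 < n%:R :> R by rewrite ltr0n.
have h1 : (n%:R * d) ^+ 2 <= C ^+ 2 * (n%:R * (M + 1)).
  have h : n%:R * d <= `|C| * Num.sqrt (n%:R * (M + 1)).
    apply: le_trans Lw _; apply: le_trans (Lb _ nw) _.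
    by apply: ler_wpM2l => //; rewrite ler_wsqrtr.
  have nd : 0 <= n%:R * d by rewrite mulr_ge0 ?ltW.
  apply: (@le_trans _ _ ((`|C| * Num.sqrt (n%:R * (M + 1))) ^+ 2)).
    by rewrite ler_pXn2r ?nnegrE// mulr_ge0 ?sqrtr_ge0.
  by rewrite exprMn real_normK ?num_real// sqr_sqrtr// mulr_ge0//; lra.
have h2 : n%:R * d ^+ 2 <= C ^+ 2 * (M + 1).
  rewrite -(ler_pM2l n1); apply: le_trans (le_trans _ h1) _; rewrite le_eqVlt; apply/orP; left; apply/eqP; ring.
have := truncnS_gt (C ^+ 2 * (M + 1) / d ^+ 2); rewrite -/n ltr_pdivrMr ?exprn_gt0//.
by rewrite ltNge h2.
Qed.

End Weak.

(** * The map z -> zeta + z^j *)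

Section Geometry.
Context {R : realType}.
Implicit Types (z zeta : plane R) (e : @expr R).

(** Allows an expression to be replaced by a shorter one with the same values before it is
    differentiated again. *)
Lemma ev_D_ext i e e' : wf e -> wf e' -> ev e = ev e' -> ev (D i e) = ev (D i e').
Proof. by move=> we we' h; rewrite -!partial_eval// h. Qed.

Fixpoint zpow (n : nat) : @expr R * @expr R :=
  if n is m.+1 then
    let: (a, b) := zpow m in
    (Add (Mul (Coord false) a) (Mul (Cst (-1)) (Mul (Coord true) b)),
     Add (Mul (Coord false) b) (Mul (Coord true) a))
  else (Cst 1, Cst 0).

Definition re n z : R := ev (zpow n).1 z.
Definition im n z : R := ev (zpow n).2 z.

Lemma reS n z : re n.+1 z = z.1 * re n z - z.2 * im n z.
Proof. by rewrite /re /im /=; case: (zpow n) => a b /=; ring. Qed.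

Lemma imS n z : im n.+1 z = z.1 * im n z + z.2 * re n z.
Proof. by rewrite /re /im /=; case: (zpow n) => a b /=; ring. Qed.

Lemma re0 z : re 0 z = 1. Proof. by []. Qed.
Lemma im0 z : im 0 z = 0. Proof. by []. Qed.

Lemma cpowE z n : cpow z n = (re n z, im n z).
Proof.
suff -> : cpow z n = (complex.Re (Complex (re n z) (im n z)), complex.Im (Complex (re n z) (im n z))) by [].
rewrite /cpow; suff -> : (Complex z.1 z.2 : R[i]) ^+ n = Complex (re n z) (im n z) by [].
elim: n => [|n IH]; first by rewrite expr0 re0 im0.
by rewrite exprS IH reS imS.
Qed.

Lemma wf_zpow n : wf (zpow n).1 /\ wf (zpow n).2.
Proof. by elim: n => //= n; case: (zpow n) => a b /=; intuition. Qed.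

Lemma zpow_norm n z : re n z ^+ 2 + im n z ^+ 2 = nrm2 z ^+ n.
Proof.
elim: n => [|n IH]; first by rewrite re0 im0 expr0n/= addr0 expr1n expr0.
by rewrite [RHS]exprS -IH reS imS /nrm2; ring.
Qed.

(** The derivative n z^(n-1) together with the Cauchy-Riemann equations. At n = 0 the index [n.-1]
    is 0 again, harmless because of the factor n. *)
Lemma D_zpow n z :
  [/\ ev (D false (zpow n).1) z = n%:R * re n.-1 z,
      ev (D true (zpow n).1) z = - n%:R * im n.-1 z,
      ev (D false (zpow n).2) z = n%:R * im n.-1 z &
      ev (D true (zpow n).2) z = n%:R * re n.-1 z].
Proof.
elim: n => [|n IH]; first by rewrite /= oppr0 !mul0r.
have Er : (zpow n.+1).1 = Add (Mul (Coord false) (zpow n).1) (Mul (Cst (-1)) (Mul (Coord true) (zpow n).2)).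
  by rewrite /=; case: (zpow n).
have Ei : (zpow n.+1).2 = Add (Mul (Coord false) (zpow n).2) (Mul (Coord true) (zpow n).1).
  by rewrite /=; case: (zpow n).
have [h1 h2 h3 h4] := IH.
rewrite Er Ei /= h1 h2 h3 h4 -/(re n z) -/(im n z) -natr1.
case: n {IH Er Ei h1 h2 h3 h4} => [|n] /=; first by rewrite re0 im0; split; ring.
by rewrite reS imS -natr1; split; ring.
Qed.

(* |zeta + z^n|^2; [jac] is the square of the modulus of its complex derivative n z^(n-1). *)
Definition modsq zeta n : expr :=
  let P := Add (Cst (zeta.1 : R)) (zpow n).1 in
  let Q := Add (Cst (zeta.2 : R)) (zpow n).2 in
  Add (Mul P P) (Mul Q Q).

Definition jac n z : R := n%:R ^+ 2 * nrm2 z ^+ n.-1.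

Lemma wf_modsq zeta n : wf (modsq zeta n).
Proof. by have [h1 h2] := wf_zpow n. Qed.

Lemma modsqE zeta n z : ev (modsq zeta n) z = nrm2 (zeta + cpow z n).
Proof. by rewrite cpowE /nrm2 /= -!expr2. Qed.

Lemma modsq_ge0 zeta n z : 0 <= ev (modsq zeta n) z.
Proof. by rewrite modsqE /nrm2 addr_ge0 ?sqr_ge0. Qed.

Lemma nrm2_ge0 z : 0 <= nrm2 z.
Proof. by rewrite /nrm2 addr_ge0 ?sqr_ge0. Qed.

Lemma modsq0E n z : ev (modsq 0 n) z = nrm2 z ^+ n.
Proof. by rewrite /= -/(re n z) -/(im n z) !add0r -!expr2 zpow_norm. Qed.

Lemma jac_ge0 n z : 0 <= jac n z.
Proof. by rewrite mulr_ge0 ?sqr_ge0// exprn_ge0// nrm2_ge0. Qed.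

Lemma D_modsq zeta n z (P := zeta.1 + re n z) (Q := zeta.2 + im n z) :
  ev (D false (modsq zeta n)) z = 2 * n%:R * (P * re n.-1 z + Q * im n.-1 z) /\
  ev (D true (modsq zeta n)) z = 2 * n%:R * (Q * re n.-1 z - P * im n.-1 z).
Proof.
have [h1 h2 h3 h4] := D_zpow n z.
rewrite /= h1 h2 h3 h4 -/(re n z) -/(im n z) /P /Q; split; ring.
Qed.

Lemma grad_modsq zeta n z :
  ev (D false (modsq zeta n)) z ^+ 2 + ev (D true (modsq zeta n)) z ^+ 2 =
  4 * ev (modsq zeta n) z * jac n z.
Proof.
have [-> ->] := D_modsq zeta n z.
by rewrite /jac -zpow_norm /= -/(re n z) -/(im n z); ring.
Qed.

(** The real and imaginary parts P, Q of a holomorphic map are harmonic, so the Laplacian of P^2 +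
    Q^2 reduces to 2 (|grad P|^2 + |grad Q|^2). *)
Lemma lap_modsq zeta n z :
  ev (D false (D false (modsq zeta n))) z + ev (D true (D true (modsq zeta n))) z = 4 * jac n z.
Proof.
have [wr wi] := wf_zpow n; have [wr' wi'] := wf_zpow n.-1.
pose P := Add (Cst (zeta.1 : R)) (zpow n).1; pose Q := Add (Cst (zeta.2 : R)) (zpow n).2.
pose e0 := Mul (Cst (2 * n%:R)) (Add (Mul P (zpow n.-1).1) (Mul Q (zpow n.-1).2)).
pose e1 := Mul (Cst (2 * n%:R)) (Add (Mul Q (zpow n.-1).1) (Mul (Cst (-1)) (Mul P (zpow n.-1).2))).
have -> : ev (D false (D false (modsq zeta n))) = ev (D false e0).
  apply: ev_D_ext; [exact/wf_D/wf_modsq|by []|].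
  by apply/funext => w; rewrite (D_modsq zeta n w).1.
have -> : ev (D true (D true (modsq zeta n))) = ev (D true e1).
  apply: ev_D_ext; [exact/wf_D/wf_modsq|by []|].
  by apply/funext => w; rewrite (D_modsq zeta n w).2 /e1/= -!/(re _ _) -!/(im _ _); ring.
have [h1 h2 h3 h4] := D_zpow n z; have [h1' h2' h3' h4'] := D_zpow n.-1 z.
rewrite /= h1 h2 h3 h4 h1' h2' h3' h4' -!/(re _ z) -!/(im _ z) /jac -zpow_norm; ring.
Qed.

(** Euler's identity for a homogeneous function of degree 2n; it evaluates divergences of radial
    fields. *)
Lemma euler_modsq n z :
  z.1 * ev (D false (modsq 0 n)) z + z.2 * ev (D true (modsq 0 n)) z =
  2 * n%:R * nrm2 z ^+ n.
Proof.
have [-> ->] := D_modsq 0 n z; rewrite !add0r.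
case: n => [|n]; first by rewrite !mulr0 !mul0r !mulr0 addr0.
by rewrite -zpow_norm reS imS /=; ring.
Qed.

(** |x . y| <= (|x|^2 + |y|^2) / 2 for the two gradients, whose squared norms [grad_modsq] provides.
    It serves where the derivative of the cutoff, a function of |z|^(2n), meets grad q. *)
Lemma grad_modsq_cross zeta n z :
  `|ev (D false (modsq 0 n)) z * ev (D false (modsq zeta n)) z +
    ev (D true (modsq 0 n)) z * ev (D true (modsq zeta n)) z| <=
  2 * (nrm2 z ^+ n + ev (modsq zeta n) z) * jac n z.
Proof.
have hp := grad_modsq 0 n z; have hq := grad_modsq zeta n z; rewrite modsq0E in hp.
move: hp hq; set a := ev _ z; set b := ev _ z; set c := ev _ z => hp; set d := ev _ z => hq.
set p := nrm2 z ^+ n in hp *; set q := ev _ z in hq *.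
have h : 2 * (p + q) * jac n z = (a ^+ 2 + b ^+ 2 + c ^+ 2 + d ^+ 2) / 2.
  have -> : a ^+ 2 + b ^+ 2 + c ^+ 2 + d ^+ 2 = 4 * p * jac n z + 4 * q * jac n z by lra.
  lra.
rewrite h ler_norml; apply/andP; split.
  have := sqr_ge0 (a + c); have := sqr_ge0 (b + d); nra.
have := sqr_ge0 (a - c); have := sqr_ge0 (b - d); nra.
Qed.

End Geometry.

#[local] Opaque modsq.

(** * Cutoffs and the mass of |z|^(2j-2) *)

Section Cutoff.
Context {R : realType}.
Implicit Types (a d s x : R).

Lemma flat0E x : 0 < x -> flat 0 x = expR (- x^-1).
Proof. by move=> x0; rewrite flat_pos// oppr0 mul0r add0r. Qed.

Lemma sqr_le_expR x : 0 <= x -> x ^+ 2 <= 4 * expR x.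
Proof.
move=> x0; have h := expR_ge1Dx (x / 2).
have -> : expR x = expR (x / 2) ^+ 2 by rewrite expr2 -expRD; congr expR; field.
have : 0 <= expR (x / 2) by exact: expR_ge0.
nra.
Qed.

Lemma flat2_le x : flat 2 x <= 4.
Proof.
have [x0|x0] := ltP 0 x; last by rewrite flat_npos.
rewrite -[2]add0r flatSS// flat0E//.
have x0' : 0 <= x^-1 by rewrite invr_ge0 ltW.
have := sqr_le_expR x0'; rewrite expRN exprVn => h.
by rewrite mulrC ler_pdivrMr ?expR_gt0.
Qed.

(* Constant (equal to [cutv d], not normalized to 1) for s <= a, zero for s >= a + d. *)
Definition cutoff a d s := flat 0 (expR (- d^-1) - flat 0 (s - a)).
Definition dcutoff a d s := - (flat 2 (expR (- d^-1) - flat 0 (s - a)) * flat 2 (s - a)).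
Definition cutE a d (e : expr) :=
  Flat 0 (Add (Cst (expR (- d^-1))) (Mul (Cst (-1)) (Flat 0 (Add e (Cst (- a)))))).

Lemma ev_cutE a d e z : ev (cutE a d e) z = cutoff a d (ev e z).
Proof. by rewrite /= mulN1r. Qed.

Lemma D_cutE i a d e z : ev (D i (cutE a d e)) z = dcutoff a d (ev e z) * ev (D i e) z.
Proof. by rewrite /dcutoff /= mulN1r !add0r; ring. Qed.

Lemma wf_cutE a d e : wf e -> wf (cutE a d e).
Proof. by move=> we /=. Qed.

#[local] Opaque cutE.

Definition cutv d : R := flat 0 (expR (- d^-1)).

Lemma cutv_gt0 d : 0 < cutv d.
Proof. by rewrite flat_gt0// expR_gt0. Qed.

Lemma cutoff_ge0 a d s : 0 <= cutoff a d s.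
Proof. exact: flat_ge0. Qed.

Lemma cutoff_in a d s : s <= a -> cutoff a d s = cutv d.
Proof.
move=> sa; have h : flat 0 (s - a) = 0 by rewrite flat_npos// subr_le0.
by rewrite /cutoff h subr0.
Qed.

(** [expR (- d^-1)] is [flat 0 d], and [flat 0] is increasing. *)
Lemma cutoff_arg a d s : 0 < d -> a + d <= s -> expR (- d^-1) - flat 0 (s - a) <= 0.
Proof.
move=> d0 h; have h' : d <= s - a by lra.
rewrite subr_le0 flat0E ?(lt_le_trans d0)// ler_expR lerN2 lef_pV2 ?posrE// (lt_le_trans d0)//.
Qed.

Lemma cutoff_out a d s : 0 < d -> a + d <= s -> cutoff a d s = 0.
Proof. by move=> d0 h; rewrite /cutoff flat_npos// cutoff_arg. Qed.

Lemma dcutoff_in a d s : s <= a -> dcutoff a d s = 0.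
Proof.
move=> sa; have h : flat 2 (s - a) = 0 by rewrite flat_npos// subr_le0.
by rewrite /dcutoff h mulr0 oppr0.
Qed.

Lemma dcutoff_out a d s : 0 < d -> a + d <= s -> dcutoff a d s = 0.
Proof. by move=> d0 h; rewrite /dcutoff flat_npos ?mul0r ?oppr0// cutoff_arg. Qed.

Lemma dcutoff_le0 a d s : dcutoff a d s <= 0.
Proof. by rewrite oppr_le0 mulr_ge0// flat_ge0. Qed.

Lemma dcutoff_ge a d s : - dcutoff a d s <= 16.
Proof.
rewrite opprK (_ : 16 = 4 * 4 :> R); last by ring.
by apply: ler_pM; rewrite ?flat_ge0 ?flat2_le.
Qed.

(** On the unit disk [n%:R * mass n] is comparable to [jac n], with constants independent of n; the
    denominator turns [mass] into an exact divergence up to a cutoff term. *)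
Definition mass n (z : plane R) : R :=
  2 * n%:R * nrm2 z ^+ n.-1 * cutoff 1 1 (nrm2 z) / (1 + nrm2 z ^+ n) ^+ 2.

Lemma modsq01E (z : plane R) : ev (modsq 0 1) z = nrm2 z.
Proof. by rewrite modsq0E expr1. Qed.

Lemma cutoff_nrm2_supp (z : plane R) : ~ sq 2 z -> cutoff 1 1 (nrm2 z) = 0.
Proof. by move=> /sq_nrm2 h; apply: cutoff_out => //; lra. Qed.

(* Divergence theorem for z |z|^(2n-2) / (1 + |z|^(2n)): its divergence is
   2n |z|^(2n-2) / (1 + |z|^(2n))^2, and where the cutoff varies (|z| >= 1) the
   field is bounded independently of n. *)
Lemma mass_bound : exists2 C0 : R, 0 <= C0 & forall n, (0 < n)%N ->
  csupp (mass n) /\ intg (mass n) <= C0.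
Proof.
(* Majorant of minus the cutoff term [g], the same for every n because |z|^(2n) / (1 + |z|^(2n)) <=
   1. *)
pose g0 z : R := -2 * dcutoff 1 1 (nrm2 z).
have cdcut : continuous (fun z : plane R => dcutoff 1 1 (nrm2 z)).
  pose e := @Mul R (Cst (-1)) (Mul (Flat 2 (Add (Cst (expR (- 1^-1))) (Mul (Cst (-1)) (Flat 0 (Add (modsq 0 1) (Cst (- 1))))))) (Flat 2 (Add (modsq 0 1) (Cst (-1))))).
  rewrite (_ : (fun z : plane R => dcutoff 1 1 (nrm2 z)) = ev e).
    by apply: continuous_eval => /=; have := @wf_modsq R 0 1; intuition.
  by apply/funext => z; rewrite /e/= modsq01E /dcutoff !mulN1r.
have sdcut : supp_in 2 (fun z : plane R => dcutoff 1 1 (nrm2 z)).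
  by move=> z /sq_nrm2 h; apply: dcutoff_out => //; lra.
have cg0 : csupp g0 by apply: csuppZ.
exists (intg g0); first by apply: intg_ge0 => z; rewrite /g0 mulNr -mulrN mulr_ge0// oppr_ge0 dcutoff_le0.
move=> n n0.
pose s : @expr R := modsq 0 n.-1; pose p : @expr R := modsq 0 n; pose y : @expr R := modsq 0 1.
pose I := Recip (Add (Cst 1) p).
pose F i := Mul (Mul (Coord i) s) (Mul I (cutE 1 1 y)).
have p0 z : 0 < 1 + ev p z by have := modsq_ge0 0 n z; rewrite -/p; lra.
have wF i : wf (F i).
  split; first by split=> //; exact: wf_modsq.
  by split; [split; [split=> //; exact: wf_modsq|exact: p0]|apply: wf_cutE; exact: wf_modsq].
have sF i : supp_in 2 (ev (F i)).
  by move=> z hz; rewrite /F [ev _ _]/= ev_cutE modsq01E cutoff_nrm2_supp// !mulr0.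
have [cdiv idiv] := intg_div (wF false) (wF true) (sF false) (sF true).
pose g z : R := nrm2 z ^+ n.-1 / (1 + nrm2 z ^+ n) * (dcutoff 1 1 (nrm2 z) * (2 * nrm2 z)).
have E z : ev (D false (F false)) z + ev (D true (F true)) z = mass n z + g z.
  have eS := euler_modsq n.-1 z; have eP := euler_modsq n z; have eY := euler_modsq 1 z.
  rewrite /F; rewrite /= !D_cutE ev_cutE -/p -/s -/y.
  rewrite -/p in eP; rewrite -/s in eS; rewrite -/y in eY.
  (* Terms are grouped by the radial derivatives of [s], [p] and [y], which [euler_modsq]
     evaluates. *)
  transitivity ((2 * ev s z + (z.1 * ev (D false s) z + z.2 * ev (D true s) z)) *
      ((1 + ev p z)^-1 * cutoff 1 1 (ev y z)) -
      (1 + ev p z)^-1 ^+ 2 * (z.1 * ev (D false p) z + z.2 * ev (D true p) z) * ev s z * cutoff 1 1 (ev y z) +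
      (1 + ev p z)^-1 * dcutoff 1 1 (ev y z) * ev s z * (z.1 * ev (D false y) z + z.2 * ev (D true y) z)).
    by ring.
  rewrite eS eP eY /mass /g /s /p /y modsq01E !modsq0E -[in RHS](prednK n0) -natr1 prednK// expr1.
  have := p0 z; rewrite /p modsq0E => h.
  have -> : n%:R = n.-1%:R + 1 :> R by rewrite natr1 prednK.
  by field; rewrite gt_eqF.
have cM : csupp (mass n).
  pose e := Mul (Mul (Cst (2 * n%:R)) s) (Mul (cutE 1 1 y) (Mul I I)).
  have -> : mass n = ev e.
    apply/funext => z; rewrite /e/= ev_cutE /s /p /y modsq01E !modsq0E /mass expr2 invfM; ring.
  split.
    apply: continuous_eval; split; first by split=> //; exact: wf_modsq.
    split; first by apply: wf_cutE; exact: wf_modsq.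
    by split; split=> //; split=> //; exact: wf_modsq.
  by move=> z hz; rewrite /e/= ev_cutE modsq01E cutoff_nrm2_supp// mul0r mulr0.
have cg : csupp g.
  have -> : g = (fun z => (ev (D false (F false)) z + ev (D true (F true)) z) + (-1) * mass n z).
    by apply/funext => z; rewrite E; ring.
  by apply: csuppD => //; exact: csuppZ.
split=> //.
have : intg (fun z => mass n z + g z) = 0.
  by rewrite -[RHS]idiv; congr intg; apply/funext => z; rewrite E.
rewrite intgD// => /eqP; rewrite addr_eq0 => /eqP ->.
rewrite -mulN1r -intgZ//; apply: le_intg => //; first exact: csuppZ.
move=> z; rewrite /g /g0; set dc := dcutoff _ _ _.
have dc0 : dc <= 0 by exact: dcutoff_le0.
have hp : 0 < 1 + nrm2 z ^+ n by have := p0 z; rewrite /p modsq0E.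
have h : nrm2 z ^+ n.-1 * nrm2 z / (1 + nrm2 z ^+ n) <= 1.
  by rewrite ler_pdivrMr// mul1r -exprSr prednK//; lra.
have -> : -1 * (nrm2 z ^+ n.-1 / (1 + nrm2 z ^+ n) * (dc * (2 * nrm2 z))) =
  (-2 * dc) * (nrm2 z ^+ n.-1 * nrm2 z / (1 + nrm2 z ^+ n)) by ring.
by rewrite ler_piMr//; nra.
Qed.

End Cutoff.

#[local] Opaque modsq cutE.

(** * Dirichlet integrals of the pulled back functions *)

Section Flux.
Context {R : realType}.

Definition dcutE (a d : R) (e : expr) :=
  Mul (Cst (-1)) (Mul (Flat 2 (Add (Cst (expR (- d^-1))) (Mul (Cst (-1)) (Flat 0 (Add e (Cst (- a)))))))
    (Flat 2 (Add e (Cst (- a))))).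

Lemma ev_dcutE a d e z : ev (dcutE a d e) z = dcutoff a d (ev e z).
Proof. by rewrite /= !mulN1r. Qed.

(** 2ac >= -2a^2 - c^2/2 in each coordinate gives |zeta + w|^2 >= |w|^2/2 - |zeta|^2 >= 1/8 -
    1/16. *)
Lemma nrm2_shift_ge (zeta w : plane R) : nrm2 zeta <= 16^-1 -> 4^-1 <= nrm2 w -> 16^-1 <= nrm2 (zeta + w).
Proof.
case: zeta w => a b [c d]; rewrite /nrm2 /= => h1 h2.
have := sqr_ge0 ((a : R) + (c : R) / 2); have := sqr_ge0 ((b : R) + (d : R) / 2); nra.
Qed.

(** 2ac <= 2a^2 + c^2/2 in each coordinate gives 3/16 + 3/4; the remaining 1/16 is room for
    [delta]. *)
Lemma nrm2_shift_le (zeta w : plane R) : nrm2 zeta <= 16^-1 -> nrm2 w <= 2^-1 -> nrm2 (zeta + w) <= 15 / 16.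
Proof.
case: zeta w => a b [c d]; rewrite /nrm2 /= => h1 h2.
have := sqr_ge0 ((c : R) - 2 * (a : R)); have := sqr_ge0 ((d : R) - 2 * (b : R)); nra.
Qed.

Lemma nrm2_cpow (z : plane R) n : nrm2 (cpow z n) = nrm2 z ^+ n.
Proof. by rewrite cpowE /nrm2 /= zpow_norm. Qed.

Section Params.
Variables (zeta : plane R) (n : nat) (L : R).
Hypothesis L4 : 4 <= L.

Definition delta : R := expR (- L).
Definition eps2 : R := 2 / ln (1 + L ^+ 2).
Definition qE := modsq zeta n.
Definition lgE := Ln (Add qE (Cst delta)).
Definition kapE := Add (Cst 2) (Mul (Cst (- (eps2 / 2))) (Ln (Add (Cst 1) (Mul lgE lgE)))).
Definition bE := Mul kapE (Recip (Add qE (Cst delta))).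
(* The field b grad q with b = kappa / (q + delta) has divergence
   |f'|^2 times two nonnegative terms: the one with kappa' dominates the
   energy density of [vE], the one with delta (as kappa >= 1) dominates
   minus the Laplacian of [lE]. The choice of [eps2] keeps kappa in [1, 2]. *)
Definition fluxE i := Mul (cutE (4^-1) (4^-1) (modsq 0 n)) (Mul bE (D i qE)).

(** The divergence of b grad q. With |grad q|^2 = 4 q |f'|^2 and laplacian q = 4 |f'|^2, the two
    terms in kappa combine through (q + delta) - q = delta. *)
Definition dens z : R :=
  let q := ev qE z in let l := ev lgE z in
  4 * jac n z * (- eps2 * l / (1 + l ^+ 2) * q / (q + delta) ^+ 2 + ev kapE z * delta / (q + delta) ^+ 2).

Lemma delta_gt0 : 0 < delta. Proof. exact: expR_gt0. Qed.

Lemma delta_le : delta <= 16^-1.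
Proof.
rewrite /delta expRN lef_pV2 ?posrE ?expR_gt0//.
apply: (@le_trans _ _ (expR 4)); last by rewrite ler_expR.
have h := expR_ge1Dx (1 : R); have -> : (4 : R) = 1 + 1 + (1 + 1) by ring.
rewrite !expRD; have h2 : 4 <= expR 1 * expR 1 :> R by nra.
nra.
Qed.

Lemma q_ge0 z : 0 <= ev qE z. Proof. exact: modsq_ge0. Qed.

Lemma w_gt0 z : 0 < ev qE z + delta.
Proof. by have := q_ge0 z; have := delta_gt0; lra. Qed.

Lemma one_lg_gt0 z : 0 < 1 + ev lgE z * ev lgE z.
Proof. by have := sqr_ge0 (ev lgE z); rewrite expr2; lra. Qed.

Lemma wf_lgE : wf lgE.
Proof. by split; [split=> //; exact: wf_modsq|exact: w_gt0]. Qed.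

Lemma wf_kapE : wf kapE.
Proof.
split=> //; split=> //; split; last exact: one_lg_gt0.
by split=> //; split; exact: wf_lgE.
Qed.

Lemma wf_bE : wf bE.
Proof. split; first exact: wf_kapE. by split; [split=> //; exact: wf_modsq|exact: w_gt0]. Qed.

Lemma wf_fluxE i : wf (fluxE i).
Proof.
split; first by apply: wf_cutE; exact: wf_modsq.
by split; [exact: wf_bE|exact/wf_D/wf_modsq].
Qed.

Lemma lnL_gt0 : 0 < ln (1 + L ^+ 2).
Proof. by have L0 : 0 < L; [have := L4; lra|rewrite ln_gt0// ltrDl exprn_gt0]. Qed.

Lemma eps2_gt0 : 0 < eps2.
Proof. by rewrite divr_gt0// lnL_gt0. Qed.

(** As q + delta lies in [e^-L, 1], its logarithm lies in [-L, 0], and [eps2 / 2 * ln (1 + L ^+ 2)]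
    is 1. *)
Lemma kap_bounds z : ev qE z + delta <= 1 -> 1 <= ev kapE z <= 2.
Proof.
move=> w1; have w0 := w_gt0 z.
rewrite /kapE [ev _ z]/= -/(ev qE z).
set l := ln (ev qE z + delta).
have l0 : l <= 0 by rewrite ln_le0.
have lL : - L <= l.
  rewrite /l -[- L]expRK ler_ln ?posrE ?expR_gt0//; have := q_ge0 z; rewrite -/delta; lra.
have h0 : 0 <= ln (1 + l * l) by rewrite ln_ge0//; nra.
have h1 : ln (1 + l * l) <= ln (1 + L ^+ 2) by rewrite ler_ln ?posrE; nra.
have := lnL_gt0; rewrite /eps2; set a := ln (1 + L ^+ 2) in h1 *; set c := ln _ in h0 h1 * => a0.
have : 0 <= c / a <= 1.
  by apply/andP; split; [rewrite divr_ge0// ltW|rewrite ler_pdivrMr// mul1r].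
have -> : - (2 / a / 2) * c = - (c / a) by field; rewrite gt_eqF.
lra.
Qed.

Lemma lg_le0 z : ev qE z + delta <= 1 -> ev lgE z <= 0.
Proof. by move=> w1; rewrite /= ln_le0. Qed.

Lemma dens_ge z : ev qE z + delta <= 1 ->
  let q := ev qE z in let l := ev lgE z in
  [/\ 4 * jac n z * (eps2 * - l / (1 + l ^+ 2) * q / (q + delta) ^+ 2) <= dens z,
      4 * jac n z * (delta / (q + delta) ^+ 2) <= dens z & 0 <= dens z].
Proof.
move=> w1 q l; have w0 := w_gt0 z; have q0 := q_ge0 z; have J0 := jac_ge0 n z.
have l0 := lg_le0 w1; have /andP[k1 k2] := kap_bounds w1; have e0 := eps2_gt0.
rewrite /dens -/q -/l; set k := ev kapE z in k1 k2 *.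
have A0 : 0 <= eps2 * - l / (1 + l ^+ 2) * q / (q + delta) ^+ 2.
  have h1 : 0 <= 1 + l ^+ 2 by have := sqr_ge0 l; lra.
  have h2 : 0 <= eps2 * - l by apply: mulr_ge0; [exact: ltW|rewrite oppr_ge0].
  by apply: mulr_ge0; [apply: mulr_ge0 => //; exact: divr_ge0|rewrite invr_ge0 sqr_ge0].
have B0 : 0 <= delta / (q + delta) ^+ 2 by rewrite divr_ge0 ?sqr_ge0// ltW// delta_gt0.
have -> : - eps2 * l / (1 + l ^+ 2) * q / (q + delta) ^+ 2 = eps2 * - l / (1 + l ^+ 2) * q / (q + delta) ^+ 2 by ring.
have -> : k * delta / (q + delta) ^+ 2 = k * (delta / (q + delta) ^+ 2) by ring.
move: A0 B0; set a := _ / (q + delta) ^+ 2; set c := delta / _ => A0 B0.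
have J4 : 0 <= 4 * jac n z by lra.
split; [|rewrite ler_wpM2l//; nra|rewrite mulr_ge0//; nra].
by rewrite ler_wpM2l//; nra.
Qed.

Definition bdry z : R := dcutoff (4^-1) (4^-1) (nrm2 z ^+ n) * ev bE z *
  (ev (D false (modsq 0 n)) z * ev (D false qE) z + ev (D true (modsq 0 n)) z * ev (D true qE) z).

Lemma div_fluxE z : ev (D false (fluxE false)) z + ev (D true (fluxE true)) z =
  cutoff (4^-1) (4^-1) (nrm2 z ^+ n) * dens z + bdry z.
Proof.
have hg := grad_modsq zeta n z; have hl := lap_modsq zeta n z.
have w0 := w_gt0 z; have o0 := one_lg_gt0 z.
have Db i : ev (D i bE) z =
  ((- eps2 * ev lgE z / (1 + ev lgE z ^+ 2)) / (ev qE z + delta) ^+ 2 - ev kapE z / (ev qE z + delta) ^+ 2) * ev (D i qE) z.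
  rewrite /= in o0 *; field.
  by rewrite expr2 !gt_eqF.
rewrite /fluxE.
have M i : ev (D i (Mul (cutE (4^-1) (4^-1) (modsq 0 n)) (Mul bE (D i qE)))) z =
  ev (D i (cutE (4^-1) (4^-1) (modsq 0 n))) z * (ev bE z * ev (D i qE) z) +
  ev (cutE (4^-1) (4^-1) (modsq 0 n)) z * (ev (D i bE) z * ev (D i qE) z + ev bE z * ev (D i (D i qE)) z) by [].
rewrite !M !Db !D_cutE ev_cutE modsq0E /bdry /dens.
transitivity (cutoff (4^-1) (4^-1) (nrm2 z ^+ n) *
   (((- eps2 * ev lgE z / (1 + ev lgE z ^+ 2)) / (ev qE z + delta) ^+ 2 - ev kapE z / (ev qE z + delta) ^+ 2) *
     (ev (D false qE) z ^+ 2 + ev (D true qE) z ^+ 2) +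
    ev bE z * (ev (D false (D false qE)) z + ev (D true (D true qE)) z)) + bdry z).
  by rewrite /bdry; ring.
rewrite hg hl -/(bdry z); congr (_ * _ + _).
rewrite -/qE (_ : ev bE z = ev kapE z / (ev qE z + delta))//.
by field; rewrite expr2 !gt_eqF.
Qed.

End Params.
End Flux.

(** * Flux through the cutoff region, linear in n *)

Section Energy.
Context {R : realType}.

Definition params (zeta : plane R) (n : nat) (L : R) :=
  [/\ nrm2 zeta <= 16^-1, (0 < n)%N & 4 <= L].

Lemma pow_lt1 (y c : R) n : 0 <= y -> (0 < n)%N -> c <= 1 -> y ^+ n < c -> y < 1.
Proof.
move=> y0 n0 c1 h; rewrite ltNge; apply/negP => y1.
by have := exprn_ege1 n y1; lra.
Qed.

Definition fluxdens zeta n (L : R) z := cutoff (4^-1) (4^-1) (nrm2 z ^+ n) * dens zeta n L z.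

Lemma q_ge (zeta z : plane R) n : nrm2 zeta <= 16^-1 -> 4^-1 <= nrm2 z ^+ n -> 16^-1 <= ev (qE zeta n) z.
Proof. by move=> h1 h2; rewrite modsqE; apply: nrm2_shift_ge => //; rewrite nrm2_cpow. Qed.

Lemma q_delta_le1 (zeta z : plane R) n L : params zeta n L -> nrm2 z ^+ n <= 2^-1 ->
  ev (qE zeta n) z + delta L <= 1.
Proof.
move=> [z16 n0 L4] h; have := delta_le L4.
have : ev (qE zeta n) z <= 15 / 16 by rewrite modsqE; apply: nrm2_shift_le => //; rewrite nrm2_cpow.
lra.
Qed.

(** Where the cutoff varies, its derivative is at most 16 in size, b at most 2 / (1/16) = 32 and the
    cross term at most 3 |f'|^2, in all 6 * 16 * 16 |f'|^2. Passing from [jac] to [n%:R * mass n]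
    costs (1 + |z|^(2n))^2 / (2 cutv 1) <= 2 / cutv 1. *)
Lemma bdry_le zeta n L z : params zeta n L ->
  - bdry zeta n L z <= (12 * 16 * 16) / cutv 1 * n%:R * mass n z.
Proof.
move=> P; have [z16 n0 L4] := P.
have c1 := cutv_gt0 (1 : R).
have y0 := nrm2_ge0 z; have p0 : 0 <= nrm2 z ^+ n by exact: exprn_ge0.
have J0 := jac_ge0 n z.
have M0 : 0 <= mass n z.
  rewrite /mass; apply: divr_ge0 (sqr_ge0 _); apply: mulr_ge0 (cutoff_ge0 _ _ _).
  by apply: mulr_ge0; [rewrite mulr_ge0|exact: exprn_ge0].
have R0 : 0 <= (12 * 16 * 16) / cutv 1 * n%:R * mass n z.
  by apply: mulr_ge0 => //; apply: mulr_ge0 => //; apply: divr_ge0 => //; exact: ltW.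
have [h|h] := leP (nrm2 z ^+ n) (4^-1).
  by rewrite /bdry dcutoff_in// !mul0r oppr0.
have [h'|h'] := leP (4^-1 + 4^-1) (nrm2 z ^+ n).
  by rewrite /bdry dcutoff_out// !mul0r oppr0.
have p2 : nrm2 z ^+ n <= 2^-1 by lra.
have w1 := q_delta_le1 P p2.
have q16 := q_ge z16 (ltW h).
have d0 := delta_gt0 L.
have /andP[k1 k2] := kap_bounds L4 w1.
have b32 : 0 <= ev (bE zeta n L) z <= 32.
  rewrite (_ : ev (bE zeta n L) z = ev (kapE zeta n L) z / (ev (qE zeta n) z + delta L))//.
  have w16 : 16^-1 <= ev (qE zeta n) z + delta L by lra.
  have w0 : 0 < ev (qE zeta n) z + delta L by lra.
  apply/andP; split; first by apply: divr_ge0; [exact: le_trans ler01 k1|exact: ltW].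
  by rewrite ler_pdivrMr//; lra.
have dc := dcutoff_ge (4^-1) (4^-1) (nrm2 z ^+ n); have dc0 := dcutoff_le0 (4^-1) (4^-1) (nrm2 z ^+ n).
have cr := grad_modsq_cross zeta n z.
have cr3 : 2 * (nrm2 z ^+ n + ev (modsq zeta n) z) * jac n z <= 3 * jac n z.
  by rewrite ler_wpM2r//; have := w1; rewrite /qE; lra.
have hb : - bdry zeta n L z <= (6 * 16 * 16) * jac n z.
  rewrite /bdry; have /andP[b0 b1] := b32; rewrite -!/(qE zeta n) in cr cr3.
  move: b0 b1 dc dc0 cr; set b := ev (bE zeta n L) z; set d := dcutoff _ _ _.
  set X := _ + _ => b0 b1 dc dc0 cr.
  apply: le_trans (ler_norm _) _; rewrite normrN 2!normrM.
  have -> : (6 * 16 * 16) * jac n z = 16 * 32 * (3 * jac n z) by ring.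
  rewrite (ger0_norm b0) (ler0_norm dc0).
  apply: ler_pM => //; last by exact: le_trans cr cr3.
    by rewrite mulr_ge0// oppr_ge0.
  by apply: ler_pM => //; rewrite oppr_ge0.
apply: le_trans hb _.
have y1 : nrm2 z <= 1 by apply/ltW/(pow_lt1 y0 n0 _ (le_lt_trans p2 _)); [exact: lexx|lra].
rewrite /mass cutoff_in// /jac.
have -> : (12 * 16 * 16) / cutv 1 * n%:R * (2 * n%:R * nrm2 z ^+ n.-1 * cutv 1 / (1 + nrm2 z ^+ n) ^+ 2) =
  (6 * 16 * 16) * (n%:R ^+ 2 * nrm2 z ^+ n.-1) * (4 / (1 + nrm2 z ^+ n) ^+ 2).
  by field; rewrite !gt_eqF//; lra.
rewrite ler_peMr//; first by rewrite mulr_ge0.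
rewrite ler_pdivlMr ?mul1r; first by nra.
by rewrite exprn_gt0//; lra.
Qed.

Lemma csupp_flux zeta n L : params zeta n L -> csupp (fluxdens zeta n L) /\
  intg (fluxdens zeta n L) = - intg (bdry zeta n L) /\ csupp (bdry zeta n L).
Proof.
move=> P; have [z16 n0 L4] := P.
have big z : ~ sq 2 z -> 2^-1 <= nrm2 z ^+ n.
  by move=> /sq_nrm2 h; apply: (@le_trans _ _ 1); [lra|apply: exprn_ege1; lra].
have sF i : supp_in 2 (ev (fluxE zeta n L i)).
  move=> z /big h; rewrite /fluxE [ev _ _]/= ev_cutE modsq0E cutoff_out ?mul0r//; lra.
have [cd id] := intg_div (wf_fluxE zeta n L false) (wf_fluxE zeta n L true) (sF false) (sF true).
have cb : csupp (bdry zeta n L).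
  split.
    pose e := Mul (Mul (dcutE (4^-1) (4^-1) (modsq 0 n)) (bE zeta n L))
      (Add (Mul (D false (modsq 0 n)) (D false (qE zeta n))) (Mul (D true (modsq 0 n)) (D true (qE zeta n)))).
    rewrite (_ : bdry zeta n L = ev e).
      have w1 i : wf (D i (modsq (0 : plane R) n)) by exact/wf_D/wf_modsq.
      have w2 i : wf (D i (qE zeta n)) by exact/wf_D/wf_modsq.
      have w3 := wf_modsq (0 : plane R) n.
      by apply: continuous_eval; split; [split; [split|exact: wf_bE]|split; split].
    by apply/funext => z; rewrite /bdry -modsq0E -ev_dcutE.
  by move=> z /big h; rewrite /bdry dcutoff_out ?mul0r//; lra.
have cf : csupp (fluxdens zeta n L).
  have -> : fluxdens zeta n L = (fun z => (ev (D false (fluxE zeta n L false)) z + ev (D true (fluxE zeta n L true)) z)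
     + (-1) * bdry zeta n L z).
    by apply/funext => z; rewrite div_fluxE /fluxdens; ring.
  by apply: csuppD => //; exact: csuppZ.
split=> //; split=> //.
apply/eqP; rewrite -addr_eq0 -intgD//; apply/eqP; rewrite -[RHS]id.
by congr intg; apply/funext => z; rewrite div_fluxE.
Qed.

(** Growth linear in n is what the factor n^(-1/2) of the operators, squared in the energy,
    compensates. *)
Lemma flux_bound : exists2 C1 : R, 0 <= C1 &
  forall zeta n L, params zeta n L -> intg (fluxdens zeta n L) <= C1 * n%:R.
Proof.
have [C0 C00 hC0] := @mass_bound R; have c1 := cutv_gt0 (1 : R).
exists ((12 * 16 * 16) / cutv 1 * C0); first by apply: mulr_ge0 => //; apply: divr_ge0 => //; exact: ltW.
move=> zeta n L P; have [cf [-> cb]] := csupp_flux P.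
have [z16 n0 L4] := P; have [cm im] := hC0 n n0.
rewrite -mulN1r -intgZ//.
apply: (@le_trans _ _ (intg (fun z => ((12 * 16 * 16) / cutv 1 * n%:R) * mass n z))).
  apply: le_intg; [exact: csuppZ|exact: csuppZ|].
  by move=> z; rewrite mulN1r; exact: bdry_le.
rewrite intgZ//; have -> : (12 * 16 * 16) / cutv 1 * C0 * n%:R = (12 * 16 * 16) / cutv 1 * n%:R * C0 by ring.
by rewrite ler_wpM2l//; apply: mulr_ge0 => //; apply: divr_ge0 => //; exact: ltW.
Qed.

End Energy.

(** * The profile and its energy density *)

Section Profile.
Context {R : realType}.

(** The shift makes it positive only for q + delta < e^-4; as e^-4 <= 1/16, this excludes |z^n| >=
    1/2 when |zeta| <= 1/4. *)
Definition aE zeta n (L : R) := Add (Mul (Cst (-1)) (lgE zeta n L)) (Cst (-4)).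
(* [vE zeta n L] is n^(-1/2) u_L(zeta + z^n), so [vE 0 1 L] is u_L itself.
   [lE] is a convex function of the same logarithm; it bounds the square of
   the profile of [vE]. *)
Definition lE zeta n (L : R) := Flat (-1) (aE zeta n L).
Definition vE zeta n (L : R) :=
  Mul (Cst (Num.sqrt (eps2 L) * (Num.sqrt n%:R)^-1)) (Flat (- 2^-1) (aE zeta n L)).

Lemma wf_aE zeta n L : wf (aE zeta n L).
Proof. by split=> //; split=> //; exact: wf_lgE. Qed.

Lemma ev_aE zeta n L z : ev (aE zeta n L) z = - ev (lgE zeta n L) z - 4.
Proof. by rewrite /=; ring. Qed.

Lemma aE_npos zeta z n L : nrm2 zeta <= 16^-1 -> 4^-1 <= nrm2 z ^+ n -> ev (aE zeta n L) z <= 0.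
Proof.
move=> h1 h2; have q16 := q_ge h1 h2; have d0 := delta_gt0 L.
have h : -4 <= ev (lgE zeta n L) z.
  rewrite -[leLHS]expRK [ev (lgE _ _ _) z]/= -/(qE zeta n) ler_ln ?posrE ?expR_gt0 ?w_gt0//.
  have := @delta_le R 4 (lexx 4); rewrite /delta; rewrite /delta in d0; lra.
rewrite ev_aE; lra.
Qed.

Lemma aE_pos zeta z n L : params zeta n L -> 0 < ev (aE zeta n L) z ->
  [/\ nrm2 z ^+ n < 4^-1, nrm2 z < 1, ev (qE zeta n) z + delta L <= 1,
   ev (lgE zeta n L) z = - (ev (aE zeta n L) z + 4) &
   cutoff (4^-1) (4^-1) (nrm2 z ^+ n) = cutv (4^-1)].
Proof.
move=> P a0; have [z16 n0 L4] := P.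
have h : nrm2 z ^+ n < 4^-1.
  by rewrite ltNge; apply/negP => /(aE_npos L z16); rewrite leNgt a0.
split=> //.
- apply: pow_lt1 h => //; [exact: nrm2_ge0|lra].
- apply: q_delta_le1 => //; lra.
- by rewrite ev_aE; lra.
- by apply: cutoff_in; exact: ltW.
Qed.

(** The left side is theta'(a)^2 for theta = sqrt a e^(-1/a); the right side is the weight from
    kappa', where l = -(a + 4). With x = 1/a it suffices that (x + 1/2)^2 (1 + 4x) <= 8 e^(2x),
    which e^(2x) >= (1 + x/2)^4 implies. *)
Lemma theta_deriv_bound (a : R) : 0 < a ->
  (flat (- 2^-1 + 2) a + - - 2^-1 * flat (- 2^-1 + 1) a) ^+ 2 <= 16 * ((a + 4) / (1 + (a + 4) ^+ 2)).
Proof.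
move=> a0; rewrite flatSS// flatS// flat_pos// !opprK.
set x := a^-1; have x0 : 0 < x by rewrite invr_gt0.
have -> : expR (2^-1 * ln a - x) = expR (ln a / 2) * expR (- x).
  by rewrite -expRD; congr expR; ring.
have e1 : expR (ln a / 2) ^+ 2 = a.
  by rewrite expr2 -expRD (_ : ln a / 2 + ln a / 2 = ln a) ?lnK//; field.
have e2 : expR (- x) ^+ 2 = expR (- (2 * x)).
  by rewrite expr2 -expRD; congr expR; ring.
have -> : (expR (ln a / 2) * expR (- x) / a ^+ 2 + 2^-1 * (expR (ln a / 2) * expR (- x) * x)) ^+ 2 =
   a * x ^+ 2 * (x + 2^-1) ^+ 2 * expR (- (2 * x)).
  by rewrite -e2 -[in RHS]e1 -exprVn -/x; ring.
have ax : a * x = 1 by rewrite mulfV// gt_eqF.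
have -> : a * x ^+ 2 = x by rewrite expr2 mulrA ax mul1r.
have h1 : x / (2 * (1 + 4 * x)) <= (a + 4) / (1 + (a + 4) ^+ 2).
  have -> : x / (2 * (1 + 4 * x)) = (2 * (a + 4))^-1.
    rewrite /x; field; rewrite !gt_eqF//; lra.
  rewrite -[leLHS]mul1r ler_pdivrMr; last by lra.
  rewrite mulrAC ler_pdivlMr; last by have := sqr_ge0 (a + 4); lra.
  nra.
apply: (@le_trans _ _ (16 * (x / (2 * (1 + 4 * x))))); last by rewrite ler_wpM2l.
rewrite expRN ler_pdivrMr ?expR_gt0//.
have h2 : (1 + x / 2) ^+ 4 <= expR (2 * x).
  have -> : 2 * x = x / 2 * 4%:R by field.
  rewrite expRM_natr; apply: lerXn2r; rewrite ?nnegrE ?expR_ge0 ?expR_ge1Dx//; lra.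
have -> : 16 * (x / (2 * (1 + 4 * x))) * expR (2 * x) = x * (8 * expR (2 * x) / (1 + 4 * x)).
  field; rewrite gt_eqF//; lra.
apply: ler_wpM2l; first exact: ltW.
rewrite ler_pdivlMr; last by lra.
apply: (@le_trans _ _ (8 * (1 + x / 2) ^+ 4)); last by rewrite ler_wpM2l.
rewrite -subr_ge0.
have -> : 8 * (1 + x / 2) ^+ 4 - (x + 2^-1) ^+ 2 * (1 + 4 * x) =
  8 - 4^-1 + 14 * x + 7 * x ^+ 2 + x ^+ 4 / 2 by field.
have := sqr_ge0 x; have := sqr_ge0 (x ^+ 2); rewrite -exprM => ? ?; lra.
Qed.

(** The derivative (1 + 1/a) e^(-1/a) of a e^(-1/a), bounded through 1 + y <= e^y. *)
Lemma flat01_le1 (a : R) : flat (-1 + 2) a + - -1 * flat (-1 + 1) a <= 1.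
Proof.
rewrite opprK mul1r; have [a0|a0] := ltP 0 a; last by rewrite !flat_npos// addr0.
have -> : -1 + 2 = 0 + 1 :> R by ring.
rewrite flatS// (_ : -1 + 1 = 0 :> R); last by ring.
rewrite flat0E// expRN; have h := expR_ge1Dx a^-1; have e0 := expR_gt0 a^-1.
have -> : (expR a^-1)^-1 / a + (expR a^-1)^-1 = (1 + a^-1) / expR a^-1 by ring.
by rewrite ler_pdivrMr// mul1r.
Qed.

Lemma D_aE i zeta n L z : ev (D i (aE zeta n L)) z = - (ev (D i (qE zeta n)) z / (ev (qE zeta n) z + delta L)).
Proof. by rewrite /aE /= -/(qE zeta n); ring. Qed.

(** The left side is (eps2 / n) theta'(a)^2 4 q |f'|^2 / (q + delta)^2, which [theta_deriv_bound]
    matches with the kappa' term of [dens]; dividing by [cutv] undoes the unnormalized cutoff. *)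
Lemma energy_density_le zeta n L z : params zeta n L ->
  ev (D false (vE zeta n L)) z * ev (D false (vE zeta n L)) z +
  ev (D true (vE zeta n L)) z * ev (D true (vE zeta n L)) z <=
  16 / (n%:R * cutv (4^-1)) * fluxdens zeta n L z.
Proof.
move=> P; have [z16 n0 L4] := P; have n0' : (0 : R) < n%:R by rewrite ltr0n.
have c0 := cutv_gt0 (4^-1 : R); have e0 := eps2_gt0 L4; have J0 := jac_ge0 n z.
set a := ev (aE zeta n L) z.
set th := flat (- 2^-1 + 2) a + - - 2^-1 * flat (- 2^-1 + 1) a.
set w := ev (qE zeta n) z + delta L.
have w0 : 0 < w by exact: w_gt0.
have Dv i : ev (D i (vE zeta n L)) z =
   Num.sqrt (eps2 L) / Num.sqrt n%:R * (th * - (ev (D i (qE zeta n)) z / w)).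
  by rewrite -D_aE /= -/a /th; ring.
rewrite !Dv.
have -> : Num.sqrt (eps2 L) / Num.sqrt n%:R * (th * - (ev (D false (qE zeta n)) z / w)) *
 (Num.sqrt (eps2 L) / Num.sqrt n%:R * (th * - (ev (D false (qE zeta n)) z / w))) +
 Num.sqrt (eps2 L) / Num.sqrt n%:R * (th * - (ev (D true (qE zeta n)) z / w)) *
 (Num.sqrt (eps2 L) / Num.sqrt n%:R * (th * - (ev (D true (qE zeta n)) z / w))) =
 (Num.sqrt (eps2 L) ^+ 2 / Num.sqrt n%:R ^+ 2) * th ^+ 2 *
   ((ev (D false (qE zeta n)) z ^+ 2 + ev (D true (qE zeta n)) z ^+ 2) / w ^+ 2).
  by field; rewrite !gt_eqF// sqrtr_gt0.
rewrite grad_modsq !sqr_sqrtr ?(ltW e0) ?(ltW n0')// -/(qE zeta n).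
have [a0|a0] := ltP 0 a; last first.
  rewrite /th !flat_npos// mulr0 addr0 expr0n/= mulr0 mul0r.
  apply: mulr_ge0; first by apply: divr_ge0 => //; apply: mulr_ge0; exact: ltW.
  rewrite /fluxdens; have [h|h] := leP (2^-1) (nrm2 z ^+ n).
    by rewrite cutoff_out ?mul0r//; lra.
  by apply: mulr_ge0 (cutoff_ge0 _ _ _) _; have [] := dens_ge L4 (q_delta_le1 P (ltW h)).
have [p4 y1 w1 lga cu] := aE_pos P a0.
rewrite /fluxdens cu.
have [h _ _] := dens_ge L4 w1; rewrite lga -/a -/w in h.
have tb := theta_deriv_bound a0; rewrite -/th in tb.
apply: (@le_trans _ _ (16 / n%:R * (4 * jac n z * (eps2 L * - - (a + 4) / (1 + (- (a + 4)) ^+ 2) *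
            ev (qE zeta n) z / w ^+ 2)))); last first.
  have -> : 16 / (n%:R * cutv (4^-1)) * (cutv (4^-1) * dens zeta n L z) = 16 / n%:R * dens zeta n L z.
    by field; rewrite !gt_eqF.
  by rewrite ler_wpM2l// divr_ge0// ltW.
have -> : 16 / n%:R * (4 * jac n z * (eps2 L * - - (a + 4) / (1 + (- (a + 4)) ^+ 2) *
            ev (qE zeta n) z / w ^+ 2)) =
   (eps2 L / n%:R * (4 * ev (qE zeta n) z * jac n z / w ^+ 2)) * (16 * ((a + 4) / (1 + (a + 4) ^+ 2))).
  by rewrite opprK sqrrN; ring.
have -> : eps2 L / n%:R * th ^+ 2 * (4 * ev (qE zeta n) z * jac n z / w ^+ 2) =
  (eps2 L / n%:R * (4 * ev (qE zeta n) z * jac n z / w ^+ 2)) * th ^+ 2 by ring.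
apply: ler_wpM2l tb; apply: mulr_ge0; first by apply: divr_ge0; exact: ltW.
apply: divr_ge0 (sqr_ge0 _); apply: mulr_ge0 => //; apply: mulr_ge0 => //; exact: q_ge0.
Qed.

End Profile.

(** * The mean of the logarithm *)

Section MeanBound.
Context {R : realType}.

Lemma outside_sq_pow (z : plane R) n : ~ sq 2 z -> 4^-1 <= nrm2 z ^+ n.
Proof. by move=> /sq_nrm2 h; apply: (@le_trans _ _ 1); [lra|apply: exprn_ege1; lra]. Qed.

Lemma flat_aE_supp zeta n (L : R) p : params zeta n L -> supp_in 2 (ev (Flat p (aE zeta n L))).
Proof.
move=> [z16 n0 L4] z /(@outside_sq_pow _ n) h.
by rewrite -[LHS]/(flat p (ev (aE zeta n L) z)) flat_npos// aE_npos.
Qed.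

Lemma fluxdens_ge0 zeta n (L : R) z : params zeta n L -> 0 <= fluxdens zeta n L z.
Proof.
move=> P; rewrite /fluxdens; have [h|h] := leP (2^-1) (nrm2 z ^+ n).
  by rewrite cutoff_out ?mul0r//; lra.
have [_ _ L4] := P.
by apply: mulr_ge0 (cutoff_ge0 _ _ _) _; have [] := dens_ge L4 (q_delta_le1 P (ltW h)).
Qed.

(* The laplacian of [eta] is -1, and [eta] is nonnegative on the unit disk. *)
Definition eta : @expr R := Mul (Cst (4^-1)) (Add (Cst 1) (Mul (Cst (-1)) (modsq 0 1))).
(** The field l grad eta - eta grad l of Green's second identity; its divergence is - l - eta *
    (laplacian of l). *)
Definition lapF zeta n (L : R) i :=
  Add (Mul (lE zeta n L) (Mul (Cst (- 2^-1)) (Coord i)))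
      (Mul (Cst (-1)) (Mul eta (D i (lE zeta n L)))).

Lemma D_modsq1 i (z : plane R) : ev (D i (modsq 0 1)) z = 2 * ev (Coord i) z.
Proof.
have [h1 h2] := D_modsq 0 1 z; case: i; rewrite ?h1 ?h2 /re /im /=; ring.
Qed.

(** The left side is - eta * (laplacian of psi(a)) with psi(a) = a e^(-1/a). Convexity discards the
    psi'' term; the rest is eta psi'(a) 4 |f'|^2 delta / (q + delta)^2, where psi' <= 1 and eta <=
    1/4. *)
Lemma div_lapF zeta n (L : R) z : params zeta n L ->
  ev (lE zeta n L) z +
  (ev (D false (lapF zeta n L false)) z + ev (D true (lapF zeta n L true)) z) <=
  (4 * cutv (4^-1))^-1 * fluxdens zeta n L z.
Proof.
move=> P; have [z16 n0 L4] := P; have c0 := cutv_gt0 (4^-1 : R).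
set a := ev (aE zeta n L) z; set w := ev (qE zeta n) z + delta L.
have w0 : 0 < w by exact: w_gt0.
(* psi'(a) and psi''(a) in the form that [D] produces; the second collapses to [flat 3 a], whence
   convexity. *)
pose t1 := flat (-1 + 2) a + - -1 * flat (-1 + 1) a.
pose t2 := (flat (-1 + 2 + 2) a + - (-1 + 2) * flat (-1 + 2 + 1) a) +
  - -1 * (flat (-1 + 1 + 2) a + - (-1 + 1) * flat (-1 + 1 + 1) a).
have t2E : t2 = flat 3 a.
  rewrite /t2 (_ : -1 + 2 + 2 = 3); last by ring.
  rewrite (_ : -1 + 2 + 1 = 2); last by ring.
  rewrite (_ : -1 + 1 + 2 = 2); last by ring.
  by ring.
have DDa i : ev (D i (D i (aE zeta n L))) z =
   - (ev (D i (D i (qE zeta n))) z / w) + ev (D i (qE zeta n)) z ^+ 2 / w ^+ 2.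
  rewrite /aE /lgE /= -/(qE zeta n) -/w; field; rewrite gt_eqF//.
have Dl i : ev (D i (lE zeta n L)) z = t1 * ev (D i (aE zeta n L)) z.
  by rewrite /lE /t1 /a /=; ring.
have DDl i : ev (D i (D i (lE zeta n L))) z =
   t2 * ev (D i (aE zeta n L)) z ^+ 2 + t1 * ev (D i (D i (aE zeta n L))) z.
  by rewrite /lE /t1 /t2 /a [in LHS]/= [in RHS]/=; ring.
have E : ev (lE zeta n L) z +
  (ev (D false (lapF zeta n L false)) z + ev (D true (lapF zeta n L true)) z) =
  - ev eta z * (ev (D false (D false (lE zeta n L))) z + ev (D true (D true (lE zeta n L))) z).
  have DF i : ev (D i (lapF zeta n L i)) z =
     - 2^-1 * (ev (D i (lE zeta n L)) z * ev (Coord i) z + ev (lE zeta n L) z)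
     - (ev (D i eta) z * ev (D i (lE zeta n L)) z + ev eta z * ev (D i (D i (lE zeta n L))) z).
    have -> : ev (D i (lapF zeta n L i)) z =
      (ev (D i (lE zeta n L)) z * (- 2^-1 * ev (Coord i) z) + ev (lE zeta n L) z *
        (0 * ev (Coord i) z + - 2^-1 * (i == i)%:R)) +
      (0 * (ev eta z * ev (D i (lE zeta n L)) z) +
        -1 * (ev (D i eta) z * ev (D i (lE zeta n L)) z + ev eta z * ev (D i (D i (lE zeta n L))) z)) by [].
    by rewrite eqxx /=; ring.
  have De i : ev (D i eta) z = - 2^-1 * ev (Coord i) z.
    by rewrite /eta [LHS]/= D_modsq1; field.
  by rewrite !DF !De; field.
rewrite E !DDl.
have [a0|a0] := leP a 0.
  rewrite t2E /t1 !flat_npos// mulr0 addr0 !mul0r !addr0 mulr0.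
  by apply: mulr_ge0 (fluxdens_ge0 _ P); rewrite invr_ge0 mulr_ge0// ltW.
have [p4 y1 w1 lga cu] := aE_pos P a0.
have [_ h _] := dens_ge L4 w1; rewrite -/w in h.
have hg := grad_modsq zeta n z; have hl := lap_modsq zeta n z; have J0 := jac_ge0 n z.
rewrite -/(qE zeta n) in hg hl.
have d0 := delta_gt0 L.
have -> : t2 * ev (D false (aE zeta n L)) z ^+ 2 + t1 * ev (D false (D false (aE zeta n L))) z +
   (t2 * ev (D true (aE zeta n L)) z ^+ 2 + t1 * ev (D true (D true (aE zeta n L))) z) =
   t2 * (ev (D false (aE zeta n L)) z ^+ 2 + ev (D true (aE zeta n L)) z ^+ 2) -
   t1 * (4 * jac n z * (delta L / w ^+ 2)).
  have -> : 4 * jac n z * (delta L / w ^+ 2) = 4 * jac n z / w - 4 * ev (qE zeta n) z * jac n z / w ^+ 2.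
    have qw : ev (qE zeta n) z = w - delta L by rewrite /w addrK.
    by rewrite qw; move: w0; clearbody w => w0; field; rewrite gt_eqF.
  by rewrite -hg -hl !DDa; ring.
have e0 : 0 <= ev eta z <= 4^-1.
  by rewrite /eta /= modsq0E expr1; have := nrm2_ge0 z; lra.
have t20 : 0 <= t2 by rewrite t2E flat_ge0.
have t10 : 0 <= t1 by rewrite /t1 opprK mul1r addr_ge0// flat_ge0.
have t11 : t1 <= 1 by exact: flat01_le1.
rewrite /fluxdens cu (_ : (4 * cutv (4^-1))^-1 * (cutv (4^-1) * dens zeta n L z) = 4^-1 * dens zeta n L z); last first.
  by field; rewrite gt_eqF.
set G := _ ^+ 2 + _ ^+ 2; have G0 : 0 <= G by rewrite addr_ge0 ?sqr_ge0.
move: h; set K := 4 * jac n z * _ => h.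
have K0 : 0 <= K by apply: mulr_ge0; [exact: mulr_ge0|apply: divr_ge0; [exact: ltW|exact: sqr_ge0]].
move: e0; set e := ev eta z => /andP[e0 e1].
have h1 : 0 <= e * (t2 * G) by apply: mulr_ge0 => //; exact: mulr_ge0.
have h2 : e * (t1 * K) <= 4^-1 * (1 * K) by apply: ler_pM => //; [exact: mulr_ge0|exact: ler_wpM2r].
lra.
Qed.

Lemma csupp_flat zeta n (L : R) p : params zeta n L -> csupp (ev (Flat p (aE zeta n L))).
Proof. by move=> P; split; [apply: continuous_eval; exact: wf_aE|exact: flat_aE_supp]. Qed.

Lemma lE_bound : exists2 C2 : R, 0 <= C2 &
  forall zeta n L, params zeta n L -> intg (ev (lE zeta n L)) <= C2 * n%:R.
Proof.
have [C1 C10 hC1] := @flux_bound R; have c0 := cutv_gt0 (4^-1 : R).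
have k0 : 0 <= (4 * cutv (4^-1))^-1 :> R by rewrite invr_ge0 mulr_ge0// ltW.
exists ((4 * cutv (4^-1))^-1 * C1); first exact: mulr_ge0.
move=> zeta n L P; have cl := csupp_flat (-1) P.
have wl : wf (lE zeta n L) by exact: wf_aE.
have wF i : wf (lapF zeta n L i).
  by split; [split|split=> //; split; [split=> //; split=> //; split=> //; exact: wf_modsq|exact: wf_D]].
have sF i : supp_in 2 (ev (lapF zeta n L i)).
  move=> z hz; have := cl.2 z hz => l0.
  rewrite -[LHS]/(ev (lE zeta n L) z * ev (Mul (Cst (- 2^-1)) (Coord i)) z +
     (-1) * (ev eta z * ev (D i (lE zeta n L)) z)) l0.
  have -> : ev (D i (lE zeta n L)) z = 0.
    by rewrite -partial_eval//; exact: (supp_derive (dir R i) cl.2 hz).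
  by rewrite mul0r !mulr0 addr0.
have [cd id] := intg_div (wF false) (wF true) (sF false) (sF true).
have [cf _] := csupp_flux P.
rewrite -[leLHS]addr0 -[X in _ + X]id -intgD//.
apply: (@le_trans _ _ (intg (fun z => (4 * cutv (4^-1))^-1 * fluxdens zeta n L z))).
  by apply: le_intg; [exact: csuppD|exact: csuppZ|move=> z; exact: div_lapF].
by rewrite intgZ// -mulrA ler_wpM2l// hC1.
Qed.

End MeanBound.

(** * Weak convergence of the pulled back sequence *)

Section Sequence.
Context {R : realType}.

Lemma wf_vE zeta n (L : R) : wf (vE zeta n L).
Proof. by split=> //; exact: wf_aE. Qed.

Lemma vE_ge0 zeta n (L : R) z : 0 <= ev (vE zeta n L) z.
Proof.
apply: mulr_ge0; last exact: flat_ge0.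
by apply: mulr_ge0; rewrite ?invr_ge0; exact: sqrtr_ge0.
Qed.

(** 2 t / sqrt n <= 1 + t^2 / n for the profile t, with t^2 <= [lE] because e^(-2/a) <= e^(-1/a).
    The support lies in the unit disk, so the constant 1 may be replaced by an integrable cutoff. *)
Lemma vE_le zeta n (L : R) z : params zeta n L ->
  ev (vE zeta n L) z <=
  Num.sqrt (eps2 L) / 2 * ((cutv 1)^-1 * cutoff 1 1 (nrm2 z) + n%:R^-1 * ev (lE zeta n L) z).
Proof.
move=> P; have [z16 n0 L4] := P; have n0' : (0 : R) < n%:R by rewrite ltr0n.
have c1 := cutv_gt0 (1 : R); have s0 := sqrtr_ge0 (eps2 L); have sn : 0 < Num.sqrt n%:R :> R by rewrite sqrtr_gt0.
rewrite -[ev (vE zeta n L) z]/(Num.sqrt (eps2 L) / Num.sqrt n%:R * flat (- 2^-1) (ev (aE zeta n L) z)).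
rewrite -[ev (lE zeta n L) z]/(flat (-1) (ev (aE zeta n L) z)).
have [a0|a0] := leP (ev (aE zeta n L) z) 0.
  rewrite !flat_npos// !mulr0 addr0.
  apply: mulr_ge0; first by apply: divr_ge0.
  by apply: mulr_ge0 (cutoff_ge0 _ _ _); rewrite invr_ge0 ltW.
have [p4 y1 w1 lga cu] := aE_pos P a0.
rewrite (cutoff_in _ (ltW y1)) mulVf ?gt_eqF//.
rewrite -!mulrA; apply: ler_wpM2l => //.
set a := ev _ _ in a0 *.
set t := flat (- 2^-1) a; have t0 : 0 <= t by exact: flat_ge0.
have tl : t ^+ 2 <= flat (-1) a.
  rewrite /t !flat_pos// expr2 -expRD ler_expR !opprK.
  have : 0 < a^-1 by rewrite invr_gt0.
  lra.
apply: (@le_trans _ _ (2^-1 * (1 + n%:R^-1 * t ^+ 2))); last first.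
  by rewrite ler_wpM2l// lerD2l ler_wpM2l// invr_ge0 ltW.
have -> : n%:R^-1 = (Num.sqrt n%:R)^-1 ^+ 2 :> R by rewrite exprVn sqr_sqrtr// ltW.
have := sqr_ge0 (1 - (Num.sqrt n%:R)^-1 * t); nra.
Qed.

Lemma vE_mean : exists2 C : R, 0 <= C &
  forall zeta n L, params zeta n L -> intg (ev (vE zeta n L)) <= Num.sqrt (eps2 L) * C.
Proof.
have [C2 C20 hC2] := @lE_bound R; have c1 := cutv_gt0 (1 : R).
have cX : csupp (fun z : plane R => cutoff 1 1 (nrm2 z)).
  split; last by move=> z /cutoff_nrm2_supp.
  rewrite (_ : (fun z : plane R => cutoff 1 1 (nrm2 z)) = ev (cutE 1 1 (modsq 0 1))).
    by apply/continuous_eval/wf_cutE/wf_modsq.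
  by apply/funext => z; rewrite ev_cutE modsq01E.
have X0 : 0 <= intg (fun z : plane R => cutoff 1 1 (nrm2 z)).
  by apply: intg_ge0 => z; exact: cutoff_ge0.
exists (2^-1 * ((cutv 1)^-1 * intg (fun z : plane R => cutoff 1 1 (nrm2 z)) + C2)).
  by apply: mulr_ge0 => //; apply: addr_ge0 => //; apply: mulr_ge0; rewrite // invr_ge0 ltW.
move=> zeta n L P; have [z16 n0 L4] := P; have n0' : (0 : R) < n%:R by rewrite ltr0n.
have cl := csupp_flat (-1) P.
have cv : csupp (ev (vE zeta n L)) by apply: csuppZ; exact: csupp_flat.
have h := le_intg cv (csuppZ (Num.sqrt (eps2 L) / 2) (csuppD (csuppZ (cutv 1)^-1 cX) (csuppZ n%:R^-1 cl)))
   (fun z => vE_le z P).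
apply: le_trans h _; rewrite intgZ; last by apply: csuppD; exact: csuppZ.
rewrite intgD; [|exact: csuppZ..]; rewrite !intgZ//.
rewrite -mulrA; apply: ler_wpM2l; first exact: sqrtr_ge0.
by rewrite ler_wpM2l// lerD2l mulrC ler_pdivrMr// hC2.
Qed.

Lemma vE_nice A zeta n (L : R) : params zeta n L ->
  (forall z, ev (qE zeta n) z < 16^-1 -> A z) -> nice A (vE zeta n L).
Proof.
move=> P hA; split; first exact: wf_vE.
(* The profile vanishes once q + delta >= e^-4. This sublevel set is closed and inside q < 1/16,
   because e^-4 <= 1/16 and [delta] > 0; the square makes it compact. *)
exists (sq 2 `&` [set z | ev (qE zeta n) z <= expR (-4) - delta L]); split.
- apply: compact_closedI; first exact: compact_sq.
  rewrite (_ : mkset _ = ev (qE zeta n) @^-1` [set t | t <= expR (-4) - delta L])//.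
  apply: closed_comp; last exact: closed_le.
  by move=> z _; apply: continuous_eval; exact: wf_modsq.
- move=> z [_ /= h]; apply: hA; have := @delta_le R 4 (lexx 4); have := delta_gt0 L.
  rewrite {2}/delta; lra.
- move=> z hz; rewrite -[LHS]/(Num.sqrt (eps2 L) / Num.sqrt n%:R * ev (Flat (- 2^-1) (aE zeta n L)) z).
  have [h|h] := pselect (sq 2 z); last by rewrite (flat_aE_supp _ P h) mulr0.
  have h2 : expR (-4) - delta L < ev (qE zeta n) z.
    by rewrite ltNge; apply/negP => h2; apply: hz; split.
  rewrite -[ev (Flat _ _) _]/(flat (- 2^-1) (ev (aE zeta n L) z)) flat_npos ?mulr0// ev_aE.
  have : -4 <= ev (lgE zeta n L) z; last by lra.
  rewrite -[leLHS]expRK [ev (lgE _ _ _) z]/= -/(qE zeta n) ler_ln ?posrE ?expR_gt0 ?w_gt0//; lra.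
Qed.

Lemma vE_nice_disk1 zeta n (L : R) : params zeta n L -> nice (disk 1) (vE zeta n L).
Proof.
move=> P; have [z16 n0 L4] := P; apply: vE_nice => // z hq; rewrite diskE// expr1n.
apply: (@pow_lt1 _ _ (4^-1) n) => //; [exact: nrm2_ge0|lra|].
by rewrite ltNge; apply/negP => /(q_ge z16); rewrite leNgt hq.
Qed.

Lemma vE_energy : exists M : R,
  forall zeta n L, params zeta n L -> dirip (vE zeta n L) (vE zeta n L) <= M.
Proof.
have [C1 C10 hC1] := @flux_bound R; have c0 := cutv_gt0 (4^-1 : R).
exists (16 / cutv (4^-1) * C1) => zeta n L P; have [z16 n0 L4] := P.
have n0' : (0 : R) < n%:R by rewrite ltr0n.
have [cf _] := csupp_flux P; have nv := vE_nice_disk1 P.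
apply: le_trans (le_intg (dirip_csupp (@subset_refl _ _) nv nv) (csuppZ _ cf) (fun z => energy_density_le z P)) _.
rewrite intgZ//.
have -> : 16 / cutv (4^-1) * C1 = 16 / (n%:R * cutv (4^-1)) * (C1 * n%:R) by field; rewrite !gt_eqF.
apply: ler_wpM2l; last exact: hC1.
by apply: divr_ge0 => //; apply: mulr_ge0; exact: ltW.
Qed.

(** [B] bounds the Laplacian of w and depends on w alone; for v >= 0 the L^1 norm is [intg (ev v)],
    the quantity that [vE_mean] controls. *)
Lemma dirip_le w : nice (disk 1) w -> exists2 B : R, 0 <= B &
  forall v, nice (disk 1) v -> (forall z, 0 <= ev v z) -> `|dirip w v| <= B * intg (ev v).
Proof.
move=> nw; have ww := nw.1.
pose lap z := ev (D false (D false w)) z + ev (D true (D true w)) z.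
have wD i : wf (D i w) by exact: wf_D.
have clap : csupp lap.
  apply: csuppD; (split; first exact/continuous_eval/wf_D/wD);
    rewrite -partial_eval//; apply: supp_derive; exact: (nice_csuppD (@subset_refl _ _) _ nw).2.
have [B B0 hB] := continuous_supp_bounded clap.1 clap.2.
exists B => // v nv v0; have wv := nv.1.
have cv := nice_csupp (@subset_refl _ _) nv.
have sF i : supp_in 2 (ev (Mul v (D i w))) by move=> z hz; rewrite /= cv.2// mul0r.
have wF i : wf (Mul v (D i w)) by [].
have [cd id] := intg_div (wF false) (wF true) (sF false) (sF true).
have cwv := dirip_csupp (@subset_refl _ _) nw nv.
have cvl := csuppMl cv clap.1.
have E : dirip w v = - intg (fun z => ev v z * lap z).
  apply/eqP; rewrite -addr_eq0 /dirip -intgD//; apply/eqP; rewrite -[RHS]id.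
  by congr intg; apply/funext => z; rewrite /lap /=; ring.
rewrite E normrN ler_norml -mulNr -!intgZ//; apply/andP; split.
  apply: le_intg => //; first exact: csuppZ.
  move=> z; have := hB z; rewrite ler_norml => /andP[h _].
  by rewrite mulrC ler_wpM2l.
apply: le_intg => //; first exact: csuppZ.
move=> z; have := hB z; rewrite ler_norml => /andP[_ h].
by rewrite mulrC ler_wpM2r.
Qed.

Definition level (k : nat) : R := k%:R + 4.

Lemma level_ge4 k : 4 <= level k.
Proof. by rewrite /level lerDr. Qed.

Lemma eps2_cvg (t : R) : 0 < t -> \forall k \near \oo, Num.sqrt (eps2 (level k)) < t.
Proof.
move=> t0; have t2 : 0 < t ^+ 2 by exact: exprn_gt0.
(* The condition [eps2 < t ^+ 2] means 1 + L^2 > e^(2 / t^2), which k > e^(2 / t^2) ensures. *)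
exists (Num.truncn (expR (2 / t ^+ 2))).+1 => // k /= hk.
rewrite -[ltRHS](ger0_norm (ltW t0)) -sqrtr_sqr ltr_sqrt// /eps2.
have l0 := lnL_gt0 (level_ge4 k).
rewrite ltr_pdivrMr// mulrC -ltr_pdivrMr// -[ltLHS]expRK ltr_ln ?posrE ?expR_gt0//; last first.
  by have := sqr_ge0 (level k); lra.
have h : expR (2 / t ^+ 2) < k%:R.
  by apply: lt_le_trans (truncnS_gt _) _; rewrite ler_nat.
have k0 : 0 <= k%:R :> R by [].
rewrite /level; nra.
Qed.

Lemma vE_weakly (zeta : nat -> plane R) (n : nat -> nat) :
  (forall k, nrm2 (zeta k) <= 16^-1) -> (forall k, (0 < n k)%N) ->
  H10_weakly_to0 (disk 1) (fun k => ev (vE (zeta k) (n k) (level k))).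
Proof.
move=> hz hn; have P k : params (zeta k) (n k) (level k) by split=> //; exact: level_ge4.
have [M hM] := vE_energy; have [C C0 hC] := vE_mean.
apply: (nice_weakly_to0 (@subset_refl _ _) (M := M)) => [k|k|w nw]; first exact: vE_nice_disk1.
  exact: hM.
have [B B0 hB] := dirip_le nw.
apply/cvgrPdist_lt => e e0.
have d0 : 0 < B * C + 1 by have := mulr_ge0 B0 C0; lra.
have [N _ hN] := eps2_cvg (divr_gt0 e0 d0).
exists N => // k /hN hk; rewrite /= sub0r normrN.
apply: le_lt_trans (hB _ (vE_nice_disk1 (P k)) (vE_ge0 _ _ _)) _.
apply: (@le_lt_trans _ _ (B * (Num.sqrt (eps2 (level k)) * C))); first by apply: ler_wpM2l => //; exact: hC.
move: hk; rewrite /= ltr_pdivlMr// => hk; apply: le_lt_trans _ hk.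
by have := sqrtr_ge0 (eps2 (level k)); nra.
Qed.

End Sequence.

(** * Lower bound for the Lorentz-Zygmund norm *)

Section Lower.
Context {R : realType}.
Local Notation mu := (@lebesgue_measure R).

(* Unlike [ge0_le_integral], no measurability is required: the integral of a
   nonnegative function is a supremum over the simple functions below it. *)
Lemma ge0_le_integral_nonmeas d (T : measurableType d) (m : {measure set T -> \bar R})
    (f g : T -> \bar R) : (forall x, 0 <= f x)%E -> (forall x, f x <= g x)%E ->
  (\int[m]_x f x <= \int[m]_x g x)%E.
Proof.
move=> f0 fg; rewrite !ge0_integralTE//; last by move=> x; exact: le_trans (f0 x) (fg x).
apply: le_ereal_sup => _ [h hf <-]; exists h => // x; exact: le_trans (hf x) (fg x).
Qed.

(** For s < c the set where |u| > s contains S, whose area exceeds t; so no such s competes in the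
    infimum. *)
Lemma rearrangement_ge (u : plane R -> R) (t c : R) (S : set (plane R)) :
  continuous u -> measurable S -> (t%:E < area R S)%E -> (forall z, S z -> c <= `|u z|) ->
  (c%:E <= rearrangement u t)%E.
Proof.
move=> cu mS tS hS; apply: le_ereal_inf_tmp => _ [s [s0 hs] <-]; rewrite lee_fin leNgt; apply/negP => sc.
have : (t%:E < t%:E)%E; last by rewrite ltxx.
apply: lt_le_trans tS (le_trans _ hs); apply: le_measure; rewrite ?inE//.
  apply: open_measurable_plane.
  rewrite (_ : mkset _ = (fun z => `|u z|) @^-1` [set y | s < y])//.
  by apply: open_comp; [move=> z _; apply: cvg_norm; exact: cu|exact: open_gt].
by move=> z Sz /=; exact: lt_le_trans sc (hS z Sz).
Qed.

Lemma flat_half_ge (a b : R) : 1 <= a -> a <= b -> (expR (-1)) * Num.sqrt a <= flat (- 2^-1) b.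
Proof.
move=> a1 ab; have a0 : 0 < a by lra.
have b0 : 0 < b by lra.
rewrite flat_pos// opprK -powR12_sqrt ?(ltW a0)// /powR gt_eqF// -expRD ler_expR.
have : ln a <= ln b by rewrite ler_ln ?posrE.
have : b^-1 <= 1 by rewrite invf_le1//; lra.
lra.
Qed.

(** The square with r^2 = t/2 has area 2t > t and lies in |z|^2 <= t. There q + delta <= 2t <= e t,
    so a >= - ln t - 5, and this is at least (1 - ln t) / 2 exactly when ln t <= -11. *)
Lemma vE_rearrangement (L t : R) : 4 <= L -> delta L <= t -> t <= expR (- 11) ->
  ((Num.sqrt (eps2 L) * (expR (-1) * Num.sqrt ((1 - ln t) / 2)))%:E <=
   rearrangement (ev (vE 0%R 1%N L)) t)%E.
Proof.
move=> L4 dt t11; have d0 := delta_gt0 L; have t0 : 0 < t by lra.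
have e0 := eps2_gt0 L4.
pose r := Num.sqrt (t / 2).
have r0 : 0 <= r by exact: sqrtr_ge0.
have r2 : r ^+ 2 = t / 2 by rewrite sqr_sqrtr// divr_ge0// ltW.
have lt11 : ln t <= -11.
  by rewrite -[leRHS]expRK ler_ln ?posrE ?expR_gt0.
apply: (@rearrangement_ge _ _ _ (sq r)).
- exact/continuous_eval/wf_vE.
- exact: measurable_sq.
- by rewrite area_sq// r2 lte_fin; lra.
move=> z [/=]; rewrite !in_itv/= => /andP[z1 z1'] /andP[z2 z2'].
have hz : nrm2 z <= t.
  have sqb (x : R) : - r <= x -> x <= r -> x ^+ 2 <= t / 2 by move=> ? ?; rewrite -r2; nra.
  by rewrite /nrm2; have := sqb _ z1 z1'; have := sqb _ z2 z2'; lra.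
apply: le_trans _ (ler_norm _).
rewrite -[leRHS]/(Num.sqrt (eps2 L) / Num.sqrt 1%:R * flat (- 2^-1) (ev (aE 0 1 L) z)).
rewrite sqrtr1 divr1; apply: ler_wpM2l; first exact: sqrtr_ge0.
apply: flat_half_ge; first by lra.
rewrite ev_aE; have -> : ev (lgE 0 1 L) z = ln (nrm2 z + delta L) by rewrite -modsq01E.
have w0 : 0 < nrm2 z + delta L by have := nrm2_ge0 z; lra.
have h1 : ln (nrm2 z + delta L) <= ln (expR 1 * t).
  rewrite ler_ln ?posrE ?mulr_gt0 ?expR_gt0//.
  have := expR_ge1Dx (1 : R); nra.
rewrite lnM ?posrE ?expR_gt0// expRK in h1.
lra.
Qed.

Lemma loglog_continuous (a b : R) : 0 < a -> b < 1 ->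
  {within `[a, b], continuous (fun t : R => ((1 - ln t) * t)^-1)}.
Proof.
move=> a0 b1; apply: continuous_in_subspaceT => t; rewrite inE/= in_itv/= => /andP[h1 h2].
have t0 : 0 < t by lra.
have lt0 : ln t <= 0 by rewrite ln_le0//; lra.
apply: cvgV; first by rewrite gt_eqF// mulr_gt0//; lra.
apply: cvgM; last exact: cvg_id.
by apply: cvgB; [exact: cvg_cst|exact: continuous_ln].
Qed.

Lemma FTC_loglog (a b : R) : 0 < a -> a < b -> b < 1 ->
  (\int[mu]_(t in `[a, b]) (((1 - ln t) * t)^-1)%:E = (ln (1 - ln a) - ln (1 - ln b))%:E)%E.
Proof.
move=> a0 ab b1.
have pos t : a <= t -> t <= b -> 0 < t /\ 0 < 1 - ln t.
  move=> at_ tb; have t0 : 0 < t by lra.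
  by split=> //; have : ln t <= 0; [rewrite ln_le0//; lra|lra].
pose F t : R := - ln (1 - ln t).
have dF t : a <= t -> t <= b -> is_derive t 1 F ((1 - ln t) * t)^-1.
  move=> h1 h2; have [t0 l0] := pos t h1 h2.
  have d1 := is_derive1_ln t0.
  have d2 : is_derive t 1 (fun t : R => 1 - ln t) (0 - t^-1) by apply: is_deriveB.
  have d3 := @is_derive1_comp _ (@ln R) (fun t => 1 - ln t) t _ _ (is_derive1_ln l0) d2.
  have d4 := is_deriveN d3.
  apply: is_derive_eq.
  by rewrite sub0r invfM mulrN opprK.
have cF t : a <= t -> t <= b -> {for t, continuous F}.
  move=> h1 h2; apply/differentiable_continuous/derivable1_diffP.
  by have := dF t h1 h2 => h; exact: ex_derive.
rewrite (@continuous_FTC2 _ (fun t => ((1 - ln t) * t)^-1) F)//.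
- by rewrite /F -EFinD; congr EFin; ring.
- exact: loglog_continuous.
- split.
  + move=> t; rewrite in_itv/= => /andP[h1 h2].
    by have := dF t (ltW h1) (ltW h2) => h; exact: ex_derive.
  + by apply: cvg_at_right_filter; apply: cF => //; exact: ltW.
  + by apply: cvg_at_left_filter; apply: cF => //; exact: ltW.
- move=> t; rewrite in_itv/= => /andP[h1 h2].
  by have := dF t (ltW h1) (ltW h2) => h; rewrite derive1E derive_val.
Qed.

End Lower.

(** * The Hardy integral and the conclusion *)

Section Final.
Context {R : realType}.
Local Notation mu := (@lebesgue_measure R).

(** 144 = 12^2 gives ln 12 <= ln (1 + L) / 2; with ln (1 + L^2) <= 2 ln (1 + L), the quotient (ln (1
    + L) - ln 12) / ln (1 + L^2) is at least 1/4. *)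
Lemma eps2_lower (L : R) : 144 <= L ->
  expR (-1) ^+ 2 / 4 <= eps2 L * expR (-1) ^+ 2 / 2 * (ln (1 + L) - ln 12).
Proof.
move=> L144; have l12 : 0 < ln (12 : R) by rewrite ln_gt0//; lra.
have h1 : 2 * ln 12 <= ln (1 + L).
  have -> : 2 * ln 12 = ln (12 * 12) :> R by rewrite lnM ?posrE//; ring.
  rewrite ler_ln ?posrE//; lra.
have h2 : ln (1 + L ^+ 2) <= 2 * ln (1 + L).
  have -> : 2 * ln (1 + L) = ln ((1 + L) * (1 + L)) :> R by rewrite lnM ?posrE; [ring|lra..].
  rewrite ler_ln ?posrE; nra.
have l0 : 0 < ln (1 + L ^+ 2) by apply: lnL_gt0; lra.
have e0 := expR_gt0 (-1 : R).
rewrite /eps2; set m := ln (1 + L ^+ 2) in h2 l0 *.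
have -> : 2 / m * expR (-1) ^+ 2 / 2 * (ln (1 + L) - ln 12) = expR (-1) ^+ 2 * ((ln (1 + L) - ln 12) / m).
  by field; rewrite gt_eqF.
apply: ler_wpM2l; first exact: sqr_ge0.
by rewrite ler_pdivlMr//; lra.
Qed.

Lemma LZ_lower (L : R) : 144 <= L ->
  (((expR (-1) ^+ 2 / 4) `^ 2^-1)%:E <= LZnorm 2 (-1) (ev (vE 0%R 1%N L)))%E.
Proof.
move=> L144; have L4 : 4 <= L by lra.
have e0 := eps2_gt0 L4; have d0 := delta_gt0 L; have e11 := expR_gt0 (-11 : R).
have delta11 : delta L < expR (-11) by rewrite ltr_expR; lra.
have e111 : expR (-11) < 1 :> R.
  by rewrite -[ltRHS](@expR0 R) ltr_expR; lra.
rewrite /LZnorm; pose G (t : R) : \bar R :=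
  (((ln (expR 1 / t) `^ (-1))%:E * rearrangement (ev (vE 0%R 1%N L)) t) `^ 2 * (t^-1)%:E)%E.
rewrite -[X in (X `^ _)%E]/(\int[mu]_(t in `]0%R, 1%R[) G t)%E.
(* For t in [e^-L, e^-11] the integrand is at least (1 - ln t)^-2 * eps2 e^-2 (1 - ln t) / 2 * t^-1,
   that is K / ((1 - ln t) t), with integral K (ln (1 + L) - ln 12). *)
pose K := eps2 L * expR (-1) ^+ 2 / 2.
have K0 : 0 <= K by apply: divr_ge0 => //; apply: mulr_ge0; [exact: ltW|exact: sqr_ge0].
have pt (t : R) : delta L <= t -> t <= expR (-11) ->
    ((K * ((1 - ln t) * t)^-1)%:E <= G t)%E.
  move=> h1 h2; have t0 : 0 < t by lra.
  have lt0 : ln t <= 0 by rewrite ln_le0//; lra.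
  have hr := vE_rearrangement L4 h1 h2.
  rewrite /G lnM ?posrE ?expR_gt0 ?invr_gt0// expRK lnV ?posrE// powR_inv1; last by lra.
  move: hr; set s := 1 - ln t; set v := _ * _; set rho := rearrangement _ _ => hr.
  have s0 : 0 < s by rewrite /s; lra.
  have v0 : 0 <= v.
    apply: mulr_ge0; first exact: sqrtr_ge0.
    by apply: mulr_ge0; [exact: expR_ge0|exact: sqrtr_ge0].
  have hv : ((s^-1 * v)%:E <= s^-1%:E * rho)%E by rewrite EFinM lee_pmul2l// lte_fin invr_gt0.
  have sv0 : 0 <= s^-1 * v by apply: mulr_ge0 => //; rewrite invr_ge0 ltW.
  have h3 : ((s^-1 * v)%:E `^ 2 <= (s^-1%:E * rho) `^ 2)%E.
    apply: gt0_ler_poweR => //.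
      by rewrite in_itv/= leey andbT lee_fin.
    by rewrite in_itv/= leey andbT; apply: le_trans hv; rewrite lee_fin.
  have -> : (K * (s * t)^-1)%:E = ((s^-1 * v)%:E `^ 2 * (t^-1)%:E)%E.
    rewrite poweR_EFin powR_mulrn// -EFinM; congr EFin.
    have -> : (s^-1 * v) ^+ 2 = s^-1 ^+ 2 * (Num.sqrt (eps2 L) ^+ 2 * (expR (-1) ^+ 2 * Num.sqrt (s / 2) ^+ 2)).
      by rewrite /v; ring.
    rewrite !sqr_sqrtr ?(ltW e0)//; last by rewrite divr_ge0// ltW.
    by rewrite /K; field; rewrite !gt_eqF.
  by apply: lee_wpmul2r => //; rewrite lee_fin invr_ge0 ltW.
have G0 (t : R) : 0 < t -> (0 <= G t)%E.
  by move=> t0; rewrite /G mule_ge0// ?poweR_ge0// lee_fin invr_ge0 ltW.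
have pos (t : R) : delta L <= t -> t <= expR (-11) -> 0 <= ((1 - ln t) * t)^-1.
  move=> h1 h2; rewrite invr_ge0 mulr_ge0//; last by lra.
  by have : ln t <= 0; [rewrite ln_le0//|]; lra.
have I1 : ((K * (ln (1 + L) - ln 12))%:E <= \int[mu]_(t in `]0%R, 1%R[) G t)%E.
  rewrite integral_mkcond.
  apply: (@le_trans _ _ (\int[mu]_t (((fun t : R => (K * ((1 - ln t) * t)^-1)%:E) \_ `[delta L, expR (-11)]) t))%E); last first.
    apply: ge0_le_integral_nonmeas => t; rewrite !patchE.
      case: ifPn => //; rewrite inE/= in_itv/= => /andP[h1 h2].
      by rewrite lee_fin mulr_ge0// pos.
    case: ifPn => [|_]; last first.
      by case: ifPn => //; rewrite inE/= in_itv/= => /andP[h1 _]; exact: G0.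
    rewrite inE/= in_itv/= => /andP[h1 h2].
    rewrite ifT; first exact: pt.
    by rewrite inE/= in_itv/=; apply/andP; split; lra.
  rewrite -integral_mkcond.
  under eq_integral do rewrite EFinM.
  rewrite ge0_integralZl//=.
  - rewrite FTC_loglog// -EFinM lee_fin /delta !expRK !opprK.
    have -> : 1 + 11 = 12 :> R by lra.
    by [].
  - apply/measurable_EFinP; apply: subspace_continuous_measurable_fun => //.
    exact: loglog_continuous.
  - by move=> t; rewrite in_itv/= => /andP[h1 h2]; rewrite lee_fin pos.
apply: (@le_trans _ _ ((K * (ln (1 + L) - ln 12))%:E `^ 2^-1)%E); last first.
  have k0 : 0 <= K * (ln (1 + L) - ln 12).
    by apply: le_trans (eps2_lower L144); rewrite divr_ge0// sqr_ge0.
  apply: gt0_ler_poweR => //; first by rewrite in_itv/= leey andbT lee_fin.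
  by rewrite in_itv/= leey andbT; apply: le_trans I1; rewrite lee_fin.
rewrite poweR_EFin lee_fin; apply: ge0_ler_powR => //.
- by rewrite nnegrE divr_ge0// sqr_ge0.
- by rewrite nnegrE; apply: le_trans (eps2_lower L144); rewrite divr_ge0// sqr_ge0.
- exact: eps2_lower.
Qed.

(** The disk is star-shaped: a union of segments that share the origin. *)
Lemma disk_connected (r : R) : 0 < r -> connected (disk r).
Proof.
move=> r0.
pose seg (z : plane R) : set (plane R) := (fun t : R => t *: z) @` `[0, 1].
have -> : disk r = \bigcup_(z in disk r) seg z.
  apply/seteqP; split=> z.
    by move=> hz; exists z => //; exists 1; [rewrite /= in_itv/= ler01 lexx|rewrite scale1r].
  move=> [w /diskE -/(_ r0) hw [t]]; rewrite /= in_itv/= => /andP[t0 t1] <-.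
  apply/diskE => //; apply: le_lt_trans hw.
  rewrite /nrm2 -![in leLHS]/(_ * _) /=.
  have -> : (t * w.1) ^+ 2 + (t * w.2) ^+ 2 = t ^+ 2 * (w.1 ^+ 2 + w.2 ^+ 2) by ring.
  by rewrite ler_piMl ?addr_ge0 ?sqr_ge0// expr_le1.
apply: bigcup_connected.
  by exists 0 => z _; exists 0; [rewrite /= in_itv/= ler01 lexx|rewrite scale0r].
move=> z _; apply: connected_continuous_connected; first exact: segment_connected.
apply: continuous_subspaceT => t.
by apply: cvgZr_tmp; exact: cvg_id.
Qed.

End Final.

Theorem mainTheorem5 (R : realType) :
  exists (Omega : set (plane R)) (u : nat -> plane R -> R),
    [/\ is_domain Omega, Omega `<=` disk 2^-1,
        (forall k, H10 Omega (u k)),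
        D_weakly_to0 Omega u &
        ~ (LZnorm 2 (-1) (u k) @[k --> \oo] --> 0%E)].
Proof.
have q0 : (0 : R) < 4^-1 by [].
exists (disk (4^-1)), (fun k => ev (vE 0 1 (level k))).
have n0 : nrm2 (0 : plane R) = 0 by rewrite /nrm2 expr0n addr0.
have P0 k : params (0 : plane R) 1 (level k).
  by split=> //; [rewrite n0 invr_ge0|exact: level_ge4].
split.
- split; [exact: open_disk|exact: disk_connected|].
  by exists 0; apply/diskE => //; rewrite n0 exprn_gt0.
- by move=> z; rewrite /disk/=; lra.
- move=> k; apply: nice_H10.
    by move=> z; rewrite /disk/=; lra.
  apply: vE_nice => // z; rewrite /qE modsq01E => h; apply/diskE => //.
  by rewrite (_ : 4^-1 ^+ 2 = 16^-1 :> R)//; lra.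
- move=> g hg.
  have /choice[jz hjz] : forall k, exists jz : nat * plane R,
      [/\ (0 < jz.1)%N, closure (disk (4^-1)) jz.2 & g k = gop jz.1 jz.2].
    by move=> k; have [j [zeta [h1 h2 h3]]] := hg k; exists (j, zeta).
  (* [zeta] lies only in the closure of the domain, so the strict bound of the open disk passes to
     the closed set |z|^2 <= 1/16. *)
  have z16 k : nrm2 (jz k).2 <= 16^-1.
    have [_ + _] := hjz k; set zeta := (jz k).2.
    have cl : closed [set z : plane R | nrm2 z <= 16^-1].
      rewrite (_ : mkset _ = nrm2 @^-1` [set t | t <= 16^-1])//.
      by apply: closed_comp; [move=> z _; exact: continuous_nrm2|exact: closed_le].
    rewrite closureE => /(_ [set z : plane R | nrm2 z <= 16^-1]); apply; split=> // z /diskE -/(_ q0) /=.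
    by rewrite (_ : 4^-1 ^+ 2 = 16^-1 :> R); [exact: ltW|lra].
  have j0 k : (0 < (jz k).1)%N by have [] := hjz k.
  (* Outside the unit disk [gop] is 0 by definition and [vE] by its support; inside, both are the
     same function of |zeta + z^j|^2. *)
  suff -> : (fun k => g k (ev (vE 0 1 (level k)))) = (fun k => ev (vE (jz k).2 (jz k).1 (level k))).
    exact: vE_weakly.
  apply/funext => k; have [_ _ ->] := hjz k; apply/funext => z.
  have P : params (jz k).2 (jz k).1 (level k) by split=> //; exact: level_ge4.
  rewrite /gop patchE; case: ifPn; last first.
    rewrite notin_setE => nz; have [_ [K [_ K1 vK]]] := vE_nice_disk1 P.
    by rewrite vK// => /K1.
  move=> _.
  rewrite -[in LHS]/(_ * _) -[ev (vE 0 1 (level k)) _]/(Num.sqrt (eps2 (level k)) / Num.sqrt 1%:R *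
    flat (- 2^-1) (ev (aE 0 1 (level k)) ((jz k).2 + cpow z (jz k).1))).
  rewrite -[RHS]/(Num.sqrt (eps2 (level k)) / Num.sqrt (jz k).1%:R *
    flat (- 2^-1) (ev (aE (jz k).2 (jz k).1 (level k)) z)).
  rewrite sqrtr1 divr1 !ev_aE.
  rewrite -[ev (lgE 0 1 _) _]/(ln (ev (modsq 0 1) _ + delta (level k))) modsq01E.
  rewrite -[ev (lgE _ _ _) _]/(ln (ev (modsq _ _) _ + delta (level k))) modsqE.
  by ring.
- move=> h.
  have c0 : 0 < ((expR (-1) ^+ 2 / 4) `^ 2^-1 : R) by rewrite powR_gt0// divr_gt0// exprn_gt0// expR_gt0.
  have [N _ hN] : \forall k \near \oo, (LZnorm 2 (-1) (ev (vE (0%R : plane R) 1%N (level k))) < ((expR (-1) ^+ 2 / 4) `^ 2^-1)%:E)%E.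
    apply: (h [set x | (x < ((expR (-1) ^+ 2 / 4) `^ 2^-1)%:E)%E]).
    apply: open_nbhs_nbhs; split; last by rewrite /= lte_fin.
    exact: open_ereal_lt_ereal.
  (* [level (N + 140)] is N + 144, large enough for [LZ_lower]. *)
  have := hN (N + 140)%N (leq_addr _ _); rewrite /= ltNge LZ_lower//.
  by rewrite /level natrD; have : (0 : R) <= N%:R by []; lra.
Qed.
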